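(* Let $n\ge 2$ be an integer. The boolean inverse monoid $C_n=\mathsf A(G_n)$ of compact open bisections of the Cuntz groupoid $G_n$ is (via the map $\psi:P_n\to C_n$, $\psi(xy^{-1})=U_{x,y}$, $\psi(0)=\emptyset$) the strong orthogonal completion of the polycyclic monoid $P_n$. The group of units of $C_n$ is (isomorphic to) the Thompson group $V_{n,1}$.
   Context: Let $A_n=\{a_1,\dots,a_n\}$, let $A_n^*$ be the free monoid of finite strings over $A_n$, $A_n^\omega$ the set of right-infinite strings (with the product topology of the discrete topology on $A_n$), and $|x|$ the length of a finite string $x$. Cuntz groupoid: $G_n$ is the set of triples $(xw,|x|-|y|,yw)\in A_n^\omega\times\mathbb Z\times A_n^\omega$ with $x,y\in A_n^*$, $w\in A_n^\omega$, with product $(z,k,z')(z',k',z'')=(z,k+k',z'')$ and inverse $(z,k,z')^{-1}=(z',-k,z)$. Its topology has as basis the sets $U_{x,y,V}=\{(xw,|x|-|y|,yw):w\in V\}$ with $x,y\in A_n^*$ and $V\subseteq A_n^\omega$ open. Put $U_{x,y}=U_{x,y,A_n^\omega}$. A bisection of a groupoid $G$ is a subset $A$ such that $a,b\in A$ and $a^{-1}a=b^{-1}b$ imply $a=b$, and $a,b\in A$ and $aa^{-1}=bb^{-1}$ imply $a=b$. $\mathsf A(G_n)$ is the set of compact open bisections of $G_n$, an inverse monoid under $AB=\{ab:a\in A,b\in B,\ ab \text{ defined}\}$ with $A^{-1}=\{a^{-1}:a\in A\}$; its zero is $\emptyset$ and its identity is the set of identities of $G_n$. Polycyclic monoid: $P_n$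 consists of $0$ and the formal elements $xy^{-1}$, $x,y\in A_n^*$, with $0$ as zero and $xy^{-1}\cdot uv^{-1}=xz\,v^{-1}$ if $u=yz$, $=x(vz)^{-1}$ if $y=uz$ (for some $z\in A_n^*$), and $=0$ otherwise. It is an inverse monoid with $(xy^{-1})^{-1}=yx^{-1}$. In an inverse semigroup with zero, the natural partial order is $s\le t$ iff $s=te$ for some idempotent $e$; joins are with respect to this order; $s,t$ are orthogonal if $s^{-1}t=0=st^{-1}$. An inverse semigroup with zero is orthogonally complete if every finite set of pairwise orthogonal elements has a join and multiplication distributes over finite orthogonal joins. Strong orthogonal completion: a homomorphism of monoids with zero $\theta:P_n\to S$ to an orthogonally complete inverse monoid $S$ is strong if $\bigvee_{i=1}^n\theta(a_ia_i^{-1})=1$. A strong homomorphism $\psi:P_n\to C$ into an orthogonally complete inverse monoid $C$ is the strong orthogonal completion of $P_n$ if for every strong homomorphism $\theta:P_n\to S$ to an orthogonally complete inverse monoid $S$ there is a unique homomorphism $\bar\theta:C\to S$ preserving finite orthogonal joins with $\bar\theta\psi=\theta$. Thompson (Higman–Thompson) group $V_{n,1}$: the group of all bijections of $A_n^\omega$ of the form $x_iw\mapsto y_iw$ ($1\le i\le m$, $w\in A_n^\omega$), where $x_1,\dots,x_m$ and $y_1,\dots,y_m$ are finite strings such that each element of $A_n^\omega$ has exactly one of the $x_i$ as a prefix and exactly one of the $y_i$ as a prefix. *)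

(* Defs.v *)
From HB Require Import structures.
From mathcomp Require Import all_boot all_order ssralg ssrint.
From mathcomp Require Import all_classical topology zify.

Set Implicit Arguments.
Unset Strict Implicit.
Unset Printing Implicit Defensive.

Import Order.TTheory GRing.Theory.

Local Open Scope classical_set_scope.

HB.mixin Record isInverseMonoid0 S of StarMonoid S := {
  zerog : S;
  mul0s : left_zero zerog (@mul S);
  muls0 : right_zero zerog (@mul S);
  mulgVg : forall s : S, (s * s^-1 * s)%g = s;
  pinv_uniq : forall s t : S,
    (s * t * s)%g = s -> (t * s * t)%g = t -> t = s^-1%g
}.

#[short(type="inverseMonoid0Type")]
HB.structure Definition InverseMonoid0 :=
  { S of isInverseMonoid0 S & StarMonoid S }.

(* That inversion is an involutive antiautomorphism (the [starMonoidType]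
   axioms) follows from the existence and uniqueness of inverses. *)
HB.factory Record Monoid_isInverseMonoid0 S of Monoid S := {
  inv : S -> S;
  zerog : S;
  mul0s : left_zero zerog (@mul S);
  muls0 : right_zero zerog (@mul S);
  mulgVg : forall s : S, (s * inv s * s)%g = s;
  mulVgV : forall s : S, (inv s * s * inv s)%g = inv s;
  pinv_uniq : forall s t : S,
    (s * t * s)%g = s -> (t * s * t)%g = t -> t = inv s
}.

HB.builders Context S of Monoid_isInverseMonoid0 S.

Lemma invK : involutive inv.
Proof. by move=> s; apply/esym/pinv_uniq; [exact: mulVgV|exact: mulgVg]. Qed.

Lemma idemM (e f : S) :
  (e * e = e)%g -> (f * f = f)%g -> (e * f * (e * f) = e * f)%g.
Proof.
move=> ee ff; set a := inv (e * f)%g.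
have efa : (e * f * a * (e * f) = e * f)%g by exact: mulgVg.
have aef : (a * (e * f) * a = a)%g by exact: mulVgV.
have aE : (f * a * e = a)%g.
  apply: pinv_uniq.
    rewrite -[RHS]efa !mulgA -[(e * f * f)%g]mulgA ff.
    by rewrite -[(e * f * a * e * e)%g]mulgA ee.
  rewrite -[in RHS]aef !mulgA -[(f * a * e * e)%g]mulgA ee.
  by rewrite -[(f * a * e * f * f)%g]mulgA ff.
have aa : (a * a = a)%g.
  by rewrite -{1 2}aE -[RHS]aE -[in RHS]aef !mulgA.
have -> : (e * f = inv a)%g by apply: pinv_uniq.
by rewrite -(pinv_uniq (s := a) (t := a)) ?aa.
Qed.

Lemma idemC (e f : S) :
  (e * e = e)%g -> (f * f = f)%g -> (e * f = f * e)%g.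
Proof.
move=> ee ff; have efef := idemM ee ff; have fefe := idemM ff ee.
have -> : (e * f = inv (e * f))%g by apply: pinv_uniq; rewrite !efef.
apply/esym/pinv_uniq.
  by rewrite -[RHS]efef !mulgA -[(e * f * f)%g]mulgA ff -[(e * f * e * e)%g]mulgA ee.
by rewrite -[RHS]fefe !mulgA -[(f * e * e)%g]mulgA ee -[(f * e * f * f)%g]mulgA ff.
Qed.

Lemma invM : {morph inv : s t / (s * t)%g >-> (t * s)%g}.
Proof.
have idl s : (s * inv s * (s * inv s) = s * inv s)%g by rewrite mulgA mulgVg.
have idr s : (inv s * s * (inv s * s) = inv s * s)%g by rewrite mulgA mulVgV.
move=> s t; apply/esym/pinv_uniq.
  rewrite -[in RHS](mulgVg s) -[in RHS](mulgVg t) !mulgA.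
  rewrite -[(s * t * inv t * inv s * s)%g]mulgA.
  rewrite -[(s * t * inv t)%g]mulgA -[(s * _ * _)%g]mulgA.
  by rewrite (idemC (idl t) (idr s)) !mulgA.
rewrite -[in RHS](mulVgV s) -[in RHS](mulVgV t) !mulgA.
rewrite -[(inv t * inv s * s)%g]mulgA -[(_ * t * inv t)%g]mulgA.
by rewrite -[(inv t * _ * _)%g]mulgA (idemC (idr s) (idl t)) !mulgA.
Qed.

HB.instance Definition _ := hasInv.Build S inv.
HB.instance Definition _ := Monoid_isStarMonoid.Build S invK invM.
HB.instance Definition _ :=
  isInverseMonoid0.Build S mul0s muls0 mulgVg pinv_uniq.

HB.end.

Section InverseMonoidTheory.
Variable S : inverseMonoid0Type.
Implicit Types (s t u e f : S) (F : set S).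

Definition idempotent_elt e := (e * e = e)%g.

Definition nat_le s t := exists2 e, idempotent_elt e & s = (t * e)%g.

Definition orthogonal s t :=
  (s^-1 * t)%g = zerog /\ (s * t^-1)%g = zerog.

Definition is_join F u :=
  (forall s, F s -> nat_le s u) /\
  (forall v, (forall s, F s -> nat_le s v) -> nat_le u v).

Definition is_meet F u :=
  (forall s, F s -> nat_le u s) /\
  (forall v, (forall s, F s -> nat_le v s) -> nat_le v u).

Definition finite_orthogonal F :=
  finite_set F /\ (forall s t, F s -> F t -> s <> t -> orthogonal s t).

Definition orthogonally_complete :=
  (forall F, finite_orthogonal F -> exists u, is_join F u) /\
  (forall F u t, finite_orthogonal F -> is_join F u ->
     is_join [set (t * s)%g | s in F] (t * u)%g /\
     is_join [set (s * t)%g | s in F] (u * t)%g).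

(* Idempotents of an inverse monoid form a meet-semilattice under the natural
   partial order, the meet being the product, with bottom [zerog] and top 1. *)
Definition boolean_idempotents :=
  exists (join : S -> S -> S) (compl : S -> S),
    forall e f g : S,
      idempotent_elt e -> idempotent_elt f -> idempotent_elt g ->
      [/\ idempotent_elt (join e f), idempotent_elt (compl e)
        & [/\ join e f = join f e, join e (join f g) = join (join e f) g,
              join e (e * f)%g = e, (e * join e f)%g = e
            & [/\ (e * join f g)%g = join (e * f)%g (e * g)%g,
                  join e (compl e) = 1%g
                & (e * compl e)%g = zerog]]].

Definition boolean_inverse_monoid :=
  [/\ orthogonally_complete,
      boolean_idempotents
    & forall s t, exists u, is_meet [set s; t] u].

Definition units : set S :=
  [set u | exists v, (u * v = 1)%g /\ (v * u = 1)%g].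

End InverseMonoidTheory.

Arguments orthogonally_complete : clear implicits.
Arguments boolean_inverse_monoid : clear implicits.
Arguments units : clear implicits.

Definition monoid0_morphism (S T : inverseMonoid0Type) (f : S -> T) :=
  monoid.monoid_morphism f /\ f zerog = zerog.

Definition preserves_orthogonal_joins (S T : inverseMonoid0Type) (f : S -> T) :=
  forall F u, finite_orthogonal F -> is_join F u -> is_join (f @` F) (f u).

Section Polycyclic.
Variable n : nat.
Notation str := (seq 'I_n).

(* [Some (x, y)] stands for the element x y^-1. *)
Definition polycyclic : Type := option (str * str).

HB.instance Definition _ := Choice.on polycyclic.

Implicit Types s t r : polycyclic.

Definition poly_mul s t : polycyclic :=
  match s, t with
  | Some (x, y), Some (u, v) =>
      if prefix y u then Some (x ++ drop (size y) u, v)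
      else if prefix u y then Some (x, v ++ drop (size u) y)
      else None
  | _, _ => None
  end.

Definition poly_one : polycyclic := Some ([::], [::]).

Definition poly_inv s : polycyclic :=
  if s is Some (x, y) then Some (y, x) else None.

(* The action of x y^-1 on finite strings by y w |-> x w, as a relation; it is
   faithful and turns [poly_mul] into composition. *)
Let rel s (a b : str) : Prop :=
  if s is Some (x, y) then exists w, a = x ++ w /\ b = y ++ w else False.

Let rel_mul s t a c :
  rel (poly_mul s t) a c <-> exists b, rel s a b /\ rel t b c.
Proof.
case: s t => [[x y]|] [[u v]|] /=; last 3 first.
- by split=> // -[b []].
- by split=> // -[b []].
- by split=> // -[b []].
case: ifPn => [/prefixP[z ->]|yu].
  rewrite drop_size_cat//=; split=> [[w [-> ->]]|[b [[w [-> ->]] [w' []]]]].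
    exists (y ++ z ++ w); split; first by exists (z ++ w); rewrite catA.
    by exists w; rewrite catA.
  rewrite -catA => /eqP; rewrite eqseq_cat// eqxx => /eqP-> ->.
  by exists w'; rewrite catA.
case: ifPn => [/prefixP[z ->]|uy].
  rewrite drop_size_cat//=; split=> [[w [-> ->]]|[b [[w [-> ->]] [w' []]]]].
    exists (u ++ z ++ w); split; first by exists w; rewrite catA.
    by exists (z ++ w); rewrite -catA.
  rewrite -catA => /eqP; rewrite eqseq_cat// eqxx => /eqP<- ->.
  by exists w; rewrite catA.
split=> // -[b [[w [_ ->]] [w' [+ _]]]].
move=> /eqP e; move: yu uy; rewrite !prefixE.
have [yu|/ltnW uy] := leqP (size y) (size u).
  move=> /negP[]; move: e; rewrite -{1}(cat_take_drop (size y) u) -catA.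
  by rewrite eqseq_cat ?size_takel// => /andP[/eqP<-].
move=> _ /negP[]; move: e; rewrite -{1}(cat_take_drop (size u) y) -catA.
by rewrite eqseq_cat ?size_takel// => /andP[/eqP->].
Qed.

Let rel_inj s t : (forall a b, rel s a b <-> rel t a b) -> s = t.
Proof.
case: s t => [[x y]|] [[u v]|] //= h.
- have [w [xE yE]] : exists w, x = u ++ w /\ y = v ++ w.
    by apply/h; exists [::]; rewrite !cats0.
  have [w' [uE vE]] : exists w, u = x ++ w /\ v = y ++ w.
    by apply/h; exists [::]; rewrite !cats0.
  have : size w = 0.
    have := congr1 size xE; rewrite uE !size_cat => /eqP.
    by rewrite -addnA -{1}[size x]addn0 eqn_add2l eq_sym addn_eq0 => /andP[_ /eqP].
  by move/size0nil => w0; rewrite xE yE w0 !cats0.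
- by exfalso; apply/(h x y); exists [::]; rewrite !cats0.
- by exfalso; apply/(h u v); exists [::]; rewrite !cats0.
Qed.

Let rel_inv s a b : rel (poly_inv s) a b <-> rel s b a.
Proof. by case: s => [[x y]|] //=; split=> -[w [-> ->]]; exists w. Qed.

Let rel_fun s a b b' : rel s a b -> rel s a b' -> b = b'.
Proof.
case: s => [[x y]|] //= [w [-> ->]] [w' [+ ->]].
by move=> /eqP; rewrite eqseq_cat// eqxx => /eqP->.
Qed.

Let rel_cofun s a a' b : rel s a b -> rel s a' b -> a = a'.
Proof. by move=> /rel_inv h /rel_inv; exact: rel_fun. Qed.

Let poly_mulA : associative poly_mul.
Proof.
move=> s t r; apply: rel_inj => a d; rewrite !rel_mul; split.
  move=> [b [h /rel_mul[c [h1 h2]]]]; exists c; split=> //.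
  by apply/rel_mul; exists b.
move=> [c [/rel_mul[b [h1 h2]] h]]; exists b; split=> //.
by apply/rel_mul; exists c.
Qed.

Let poly_mul1 : left_id poly_one poly_mul.
Proof. by case=> [[u v]|] //=; rewrite prefix0s drop0. Qed.

Let poly_mulr1 : right_id poly_one poly_mul.
Proof.
case=> [[u v]|] //=; case: v => [|a v] /=; first by rewrite cats0.
by rewrite ?prefix0s.
Qed.

HB.instance Definition _ :=
  isMonoid.Build polycyclic poly_mulA poly_mul1 poly_mulr1.

Let poly_mul0 : left_zero None poly_mul. Proof. by []. Qed.
Let poly_mulr0 : right_zero None poly_mul. Proof. by case=> [[]|]. Qed.

Let poly_mulgVg s : poly_mul (poly_mul s (poly_inv s)) s = s.
Proof.
apply: rel_inj => a b; split.
  move=> /rel_mul[c [/rel_mul[d [ad /rel_inv cd]] cb]].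
  by rewrite (rel_cofun ad cd).
move=> ab; apply/rel_mul; exists a; split=> //.
by apply/rel_mul; exists b; split=> //; apply/rel_inv.
Qed.

Let poly_invK s : poly_inv (poly_inv s) = s.
Proof. by case: s => [[]|]. Qed.

Let poly_mulVgV s :
  poly_mul (poly_mul (poly_inv s) s) (poly_inv s) = poly_inv s.
Proof. by have := poly_mulgVg (poly_inv s); rewrite poly_invK. Qed.

Let poly_pinv_uniq s t : poly_mul (poly_mul s t) s = s ->
  poly_mul (poly_mul t s) t = t -> t = poly_inv s.
Proof.
have half r r' a b : poly_mul (poly_mul r r') r = r -> rel r a b -> rel r' b a.
  move=> e ab; move: (ab); rewrite -{1}e => /rel_mul[c [/rel_mul[d [ad dc]] cb]].
  by rewrite (rel_fun ab ad) (rel_cofun ab cb).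
move=> sts tst; apply: rel_inj => a b; rewrite rel_inv.
by split; apply: half.
Qed.

HB.instance Definition _ := Monoid_isInverseMonoid0.Build polycyclic
  poly_mul0 poly_mulr0 poly_mulgVg poly_mulVgV poly_pinv_uniq.

Definition gen (i : 'I_n) : polycyclic := Some ([:: i], [::]).

End Polycyclic.

Definition omega_word (n : nat) : Type :=
  prod_topology (fun _ : nat => discrete_topology 'I_n).

HB.instance Definition _ n := Topological.on (omega_word n).

Section OmegaWord.
Variable n : nat.
Implicit Types (x y z : seq 'I_n) (v w : omega_word n).

Definition scons (a : 'I_n) w : omega_word n :=
  fun k => if k is j.+1 then w j else a.

Definition catw x w : omega_word n := foldr scons w x.

Lemma catwA x y w : catw (x ++ y) w = catw x (catw y w).
Proof. by rewrite /catw foldr_cat. Qed.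

Lemma scons_inj a b v w : scons a v = scons b w -> a = b /\ v = w.
Proof.
move=> e; split; first by have := congr1 (@^~ 0%N) e.
by apply/funext => k; have := congr1 (@^~ k.+1) e.
Qed.

Lemma catw_inj x : injective (catw x).
Proof. by elim: x => //= a x ih v w /scons_inj[_ /ih]. Qed.

Lemma catw_eq x y v w : (size x <= size y)%N -> catw x v = catw y w ->
  exists2 z, y = x ++ z & v = catw z w.
Proof.
elim: x y => [|a x ih] [|b y] //=; first by exists [::].
- by move=> _ ->; exists (b :: y).
- by rewrite ltnS => xy /scons_inj[-> /(ih _ xy)[z -> ->]]; exists z.
Qed.

Lemma catw_lt x v w i : (i < size x)%N -> catw x v i = catw x w i.
Proof. by elim: x i => // a x ih [|i] //=; exact: ih. Qed.

Lemma catw_ge x w i : catw x w (size x + i)%N = w i.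
Proof. by elim: x. Qed.

Lemma catw_surj x w w' : (forall i, (i < size x)%N -> w' i = catw x w i) ->
  exists v, w' = catw x v.
Proof.
elim: x w' => [|a x ih] w' h; first by exists w'.
have [|v e] := ih (fun k => w' k.+1); first by move=> i ix; exact: (h i.+1).
exists v; apply/funext => -[|k] /=; first by rewrite (h 0%N).
by rewrite -[catw x v]e.
Qed.

Lemma omega_word_compact : compact [set: omega_word n].
Proof.
have := @tychonoff nat (fun _ => discrete_topology 'I_n) (fun=> setT).
have fc (i : nat) : compact [set: discrete_topology 'I_n].
  by apply: finite_compact; exact: (@finite_finset 'I_n).
move=> /(_ fc).
by congr (compact _); rewrite eqEsubset.
Qed.

Lemma open_wordP (V : set (omega_word n)) :
  open V <-> forall w, V w -> exists k, forall w',
    (forall i, (i < k)%N -> w' i = w i) -> V w'.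
Proof.
split=> [oV w Vw|hV].
  pose B k := [set w' : omega_word n | forall i, (i < k)%N -> w' i = w i].
  pose F : set_system (omega_word n) := filter_from setT B.
  have FF : Filter F.
    apply: filter_from_filter; first by exists 0%N.
    move=> i j _ _; exists (maxn i j) => // w' h.
    by split=> k kl; apply: h; rewrite leq_max kl ?orbT.
  have Fw : F --> w.
    apply/cvg_sup => i; apply/cvg_image.
      by rewrite eqEsubset; split=> // a _; exists (fun=> a).
    move=> A /principal_filterP Aw; exists (@^~ i @^-1` A).
      by exists i.+1 => // w' h; rewrite /preimage/= h.
    by apply: image_preimage; rewrite eqEsubset; split=> // a _; exists (fun=> a).
  have [k _ kV] := Fw V (open_nbhs_nbhs (conj oV Vw)).
  by exists k.
rewrite openE => w /hV[k kV]; rewrite /interior.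
have : nbhs w [set w' : omega_word n | forall i, (i < k)%N -> w' i = w i].
  elim: k {kV} => [|k ih]; first by apply: filterS filterT.
  have nk : nbhs w (@proj nat (fun=> discrete_topology 'I_n) k @^-1` [set w k]).
    by apply: proj_continuous; exact: discrete_set1.
  apply: filterS (filterI ih nk) => w' [h' e] i; rewrite ltnS leq_eqVlt.
  by move=> /predU1P[->|/h'].
by apply: filterS.
Qed.

End OmegaWord.

Definition cuntz_arrows (n : nat) :
    set (omega_word n * int * omega_word n) :=
  [set g | exists x y w,
    g = (catw x w, ((size x)%:Z - (size y)%:Z)%R, catw y w)].

Definition cuntz (n : nat) : Type := set_type (@cuntz_arrows n).

HB.instance Definition _ n := Choice.on (cuntz n).

Section Cuntz.
Variable n : nat.
Notation G := (cuntz n).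
Notation str := (seq 'I_n).
Implicit Types (x y z u v : str) (w : omega_word n) (g h a b c : G).
Implicit Types (A B : set G) (V : set (omega_word n)).

(* For an arrow g, [gcod g] and [gdom g] represent the identities g g^-1 and
   g^-1 g. *)
Definition gcod g : omega_word n := (val g).1.1.
Definition gdeg g : int := (val g).1.2.
Definition gdom g : omega_word n := (val g).2.

Lemma arrow_inv g : cuntz_arrows (gdom g, (- gdeg g)%R, gcod g).
Proof.
have [x [y [w e]]] := set_valP g; exists y, x, w.
by rewrite /gdom /gdeg /gcod e /= opprB.
Qed.

Lemma arrow_comp g h : gdom g = gcod h ->
  cuntz_arrows (gcod g, (gdeg g + gdeg h)%R, gdom h).
Proof.
have [x [y [w e]]] := set_valP g; have [u [v [w' e']]] := set_valP h.
rewrite /gdom /gdeg /gcod e e' /= => yu.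
have [le|/ltnW le] := leqP (size y) (size u).
  have [z -> ->] := catw_eq le yu; exists (x ++ z), v, w'.
  by rewrite catwA !size_cat; congr (_, _, _); lia.
have [z -> ->] := catw_eq le (esym yu); exists x, (v ++ z), w.
by rewrite catwA !size_cat; congr (_, _, _); lia.
Qed.

Definition mk_arrow t (tG : cuntz_arrows t) : G :=
  exist (fun t => t \in @cuntz_arrows n) t (mem_set tG).

Definition ginv g : G := mk_arrow (arrow_inv g).

(* [None] when the product is undefined. *)
Definition gcomp g h : option G :=
  if pselect (gdom g = gcod h) is left e
  then Some (mk_arrow (arrow_comp e)) else None.

Lemma gcompP g h c : gcomp g h = Some c <->
  gdom g = gcod h /\ val c = (gcod g, (gdeg g + gdeg h)%R, gdom h).
Proof.
rewrite /gcomp; case: pselect => [e|ne]; last by split=> // -[].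
split=> [[<-]//|[_ ce]].
by congr Some; apply: val_inj; rewrite ce.
Qed.

Definition basic_set x y V : set G :=
  [set g | exists2 w, V w &
    val g = (catw x w, ((size x)%:Z - (size y)%:Z)%R, catw y w)].

Definition basis : set (set G) :=
  [set B | exists x y V, open V /\ B = basic_set x y V].

Lemma basic_set_cases x y V x' y' V' g :
  basic_set x y V g -> basic_set x' y' V' g ->
  (exists z, x' = x ++ z /\ y' = y ++ z) \/
  (exists z, x = x' ++ z /\ y = y' ++ z).
Proof.
wlog xx' : x y V x' y' V' / (size x <= size x')%N => [H|].
  have [|/ltnW] := leqP (size x) (size x'); first exact: H.
  by move=> le g1 g2; have [|] := H _ _ _ _ _ _ le g2 g1; [right|left].
move=> [w _ ge] [w' _]; rewrite ge => -[xw d yw]; left.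
have le : (size y <= size y')%N by lia.
have [z x'E wE] := catw_eq xx' xw.
have [z' y'E wE'] := catw_eq le yw.
exists z; split=> //; rewrite y'E; congr (_ ++ _).
have zz' : size z' = size z by move: d; rewrite x'E y'E !size_cat; lia.
have lez : (size z <= size z')%N by rewrite zz'.
have [t z'E _] := catw_eq lez (etrans (esym wE) wE').
have /size0nil t0 : size t = 0%N by move: zz'; rewrite z'E size_cat; lia.
by rewrite z'E t0 cats0.
Qed.

Lemma basic_set_cat x y z V :
  basic_set (x ++ z) (y ++ z) V = basic_set x y (catw z @` V).
Proof.
apply/seteqP; split=> g.
  move=> [w Vw e]; exists (catw z w); first by exists w.
  by rewrite e !catwA !size_cat; congr (_, _, _); lia.
move=> [_ [w Vw <-] e]; exists w => //.
by rewrite e !catwA !size_cat; congr (_, _, _); lia.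
Qed.

Lemma open_catw z V : open V -> open (catw z @` V).
Proof.
move=> /open_wordP oV; apply/open_wordP => _ [w /oV[k kV] <-].
exists (size z + k)%N => w' h.
have [|w'' w''E] := @catw_surj _ z w w'.
  by move=> i iz; apply: h; exact: ltn_addr.
exists w'' => //; apply: kV => i ik.
by rewrite -(catw_ge z) -w''E h ?ltn_add2l// catw_ge.
Qed.

Lemma open_catwV z V : open V -> open (catw z @^-1` V).
Proof.
move=> /open_wordP oV; apply/open_wordP => w /oV[k kV].
exists k => w' h; apply: kV => i ik /=.
have [iz|zi] := ltnP i (size z); first by rewrite (catw_lt w' w iz).
by rewrite -(subnKC zi) !catw_ge h// (leq_ltn_trans _ ik)// leq_subr.
Qed.

Let basis_cover : \bigcup_(B in basis) B = setT.
Proof.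
rewrite -subTset => g _; have [x [y [w e]]] := set_valP g.
exists (basic_set x y setT); last by exists w.
by exists x, y, setT; split=> //; exact: openT.
Qed.

Let basis_join B B' g : basis B -> basis B' -> B g -> B' g ->
  exists D, [/\ basis D, D g & D `<=` B `&` B'].
Proof.
wlog H : B B' / exists x y z V V', [/\ open V, open V', B = basic_set x y V
    & B' = basic_set (x ++ z) (y ++ z) V'].
  move=> W bB bB' Bg B'g; have := bB => -[x [y [V [oV BE]]]].
  have := bB' => -[x' [y' [V' [oV' B'E]]]].
  have := Bg; have := B'g; rewrite {1}BE {1}B'E => h1 h2.
  have [[z [xE yE]]|[z [xE yE]]] := basic_set_cases h2 h1.
    by apply: W => //; exists x, y, z, V, V'; rewrite -xE -yE.
  rewrite setIC; apply: W => //.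
  by exists x', y', z, V', V; rewrite -xE -yE.
move: H => [x [y [z [V [V' [oV oV' -> ->]]]]]] _ _.
rewrite basic_set_cat => -[w Vw gw] [w' V'w' gw'].
have ww' : w = w' by apply: (@catw_inj _ x); move: gw; rewrite gw' => -[->].
exists (basic_set x y (V `&` (catw z @` V'))); split.
- by exists x, y, (V `&` (catw z @` V')); split=> //; apply: openI => //; exact: open_catw.
- by exists w => //; split=> //; rewrite ww'.
- by move=> h [v [Vv V'v] hv]; split; exists v.
Qed.

HB.instance Definition _ :=
  isBaseTopological.Build (cuntz n) basis_cover basis_join.

Lemma open_basic x y V : open V -> open (basic_set x y V).
Proof.
move=> oV; exists [set basic_set x y V]; last by rewrite bigcup_set1.
by move=> _ ->; exists x, y, V.
Qed.

Lemma open_cuntzP A g : open A -> A g ->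
  exists x y V, [/\ open V, basic_set x y V g & basic_set x y V `<=` A].
Proof.
move=> [D sD <-] [B DB Bg]; have [x [y [V [oV BE]]]] := sD _ DB.
exists x, y, V; rewrite -BE; split=> //.
by move=> h Bh; exists B.
Qed.

End Cuntz.

Section Bisections.
Variable n : nat.
Notation G := (cuntz n).
Notation str := (seq 'I_n).
Implicit Types (x y z u v : str) (w : omega_word n) (g h a b c : G).
Implicit Types (A B C : set G).

Definition bisection A :=
  forall a b, A a -> A b ->
    (gcomp (ginv a) a = gcomp (ginv b) b -> a = b) /\
    (gcomp a (ginv a) = gcomp b (ginv b) -> a = b).

Definition set_mul A B : set G :=
  [set c | exists a b, [/\ A a, B b & gcomp a b = Some c]].

Definition set_inv A : set G := @ginv n @` A.

Definition identities : set G :=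
  [set e | exists a, gcomp (ginv a) a = Some e].

Definition cuntz_bisections : set (set G) :=
  [set A | [/\ compact A, open A & bisection A]].

Definition cylinder x y : set G := basic_set x y setT.

Lemma arrowP g h : gcod g = gcod h -> gdeg g = gdeg h -> gdom g = gdom h -> g = h.
Proof.
rewrite /gcod /gdeg /gdom => e1 e2 e3; apply: val_inj.
case: (val g) (val h) e1 e2 e3 => [[? ?] ?] [[? ?] ?] /= -> -> -> //.
Qed.

Lemma gcodV g : gcod (ginv g) = gdom g. Proof. by []. Qed.
Lemma gdomV g : gdom (ginv g) = gcod g. Proof. by []. Qed.
Lemma gdegV g : gdeg (ginv g) = (- gdeg g)%R. Proof. by []. Qed.

Lemma ginvK : involutive (@ginv n).
Proof. by move=> g; apply: arrowP; rewrite ?gdegV ?opprK. Qed.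

Lemma gcompE g h c : gcomp g h = Some c <->
  [/\ gdom g = gcod h, gcod c = gcod g, gdeg c = (gdeg g + gdeg h)%R
    & gdom c = gdom h].
Proof.
rewrite gcompP; split=> [[e ce]|[e c1 c2 c3]]; first by rewrite /gcod /gdeg /gdom ce.
by split=> //; rewrite -c1 -c2 -c3 /gcod /gdeg /gdom; case: (val c) => -[].
Qed.

Lemma gcomp_ex g h : gdom g = gcod h -> exists c, gcomp g h = Some c.
Proof. by move=> e; rewrite /gcomp; case: pselect => // e'; eexists. Qed.

Lemma bisectionP A : bisection A <-> forall a b, A a -> A b ->
  (gdom a = gdom b -> a = b) /\ (gcod a = gcod b -> a = b).
Proof.
have E1 a b : gdom a = gdom b <-> gcomp (ginv a) a = gcomp (ginv b) b.
  have [c cE] := @gcomp_ex (ginv a) a erefl.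
  rewrite cE; move: cE => /gcompE[_ c1 c2 c3].
  split=> [e|/esym/gcompE[_ _ _]]; last by rewrite c3.
  by apply/esym/gcompE; rewrite c1 c2 c3 !gcodV !gdegV !addNr.
have E2 a b : gcod a = gcod b <-> gcomp a (ginv a) = gcomp b (ginv b).
  have [c cE] := @gcomp_ex a (ginv a) erefl.
  rewrite cE; move: cE => /gcompE[_ c1 c2 c3].
  split=> [e|/esym/gcompE[_ + _ _]]; last by rewrite c1.
  by apply/esym/gcompE; rewrite c1 c2 c3 !gdomV !gdegV !addrN.
split=> H a b Aa Ab; have [h1 h2] := H a b Aa Ab.
  by split=> /[dup] e; [move/E1|move/E2]; auto.
by split=> [/E1|/E2].
Qed.

Lemma gcompA a b c d e f : gcomp a b = Some d -> gcomp d c = Some e ->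
  gcomp b c = Some f -> gcomp a f = Some e.
Proof.
move=> /gcompE[ab d1 d2 d3] /gcompE[dc e1 e2 e3] /gcompE[bc f1 f2 f3].
by apply/gcompE; split; rewrite ?f1 ?e1 ?e2 ?d2 ?e3 ?f3 ?f2 ?addrA.
Qed.

Lemma set_mulA : associative set_mul.
Proof.
move=> A B C; apply/seteqP; split=> e.
  move=> [a [f [Aa [b [c [Bb Cc bc]]] af]]].
  have [d abd] : exists d, gcomp a b = Some d.
    apply: gcomp_ex; move: af bc => /gcompE[-> _ _ _] /gcompE[_ -> _ _] //.
  exists d, c; split=> //; first by exists a, b.
  move: af bc abd => /gcompE[af e1 e2 e3] /gcompE[bc f1 f2 f3] /gcompE[ab d1 d2 d3].
  by apply/gcompE; split; rewrite ?d3 ?d1 ?d2 ?e1 ?e2 ?e3 ?f2 ?addrA.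
move=> [d [c [[a [b [Aa Bb ab]]] Cc dc]]].
have [f bcf] : exists f, gcomp b c = Some f.
  by apply: gcomp_ex; move: ab dc => /gcompE[_ _ _ <-] /gcompE[].
exists a, f; split=> //; first by exists b, c.
exact: gcompA ab dc bcf.
Qed.

Lemma identitiesP e : identities e <-> gcod e = gdom e /\ gdeg e = 0%R.
Proof.
split=> [[a /gcompE[_ -> -> ->]]|[ee e0]]; first by rewrite gdegV addNr.
by exists e; apply/gcompE; rewrite !gcodV !gdegV e0 oppr0 addr0.
Qed.

Lemma set_mul1 : left_id identities set_mul.
Proof.
move=> A; apply/seteqP; split=> [c [e [a [/identitiesP[e1 e2] Aa]]]|a Aa].
  move=> /gcompE[ea c1 c2 c3]; suff -> : c = a by [].
  by apply: arrowP; rewrite ?c1 ?c2 ?c3 ?e1 ?ea ?e2 ?add0r.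
have [e ee] := @gcomp_ex a (ginv a) erefl.
exists e, a; split=> //.
  by exists (ginv a); rewrite ginvK.
move: ee => /gcompE[_ e1 e2 e3]; apply/gcompE; split=> //.
by rewrite e2 gdegV addrN add0r.
Qed.

Lemma set_mulr1 : right_id identities set_mul.
Proof.
move=> A; apply/seteqP; split=> [c [a [e [Aa /identitiesP[e1 e2]]]]|a Aa].
  move=> /gcompE[ea c1 c2 c3]; suff -> : c = a by [].
  by apply: arrowP; rewrite ?c1 ?c2 ?c3 -?e1 ?ea ?e2 ?addr0.
have [e ee] := @gcomp_ex (ginv a) a erefl.
exists a, e; split=> //; first by exists a.
move: ee => /gcompE[_ e1 e2 e3]; apply/gcompE; split=> //.
by rewrite e2 gdegV addNr addr0.
Qed.

Lemma set_mulgVg A : bisection A -> set_mul (set_mul A (set_inv A)) A = A.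
Proof.
move=> /bisectionP bA; apply/seteqP; split=> [c|a Aa].
  move=> [d [a [[b [_ [Ab [a' Aa' <-]]]]]]].
  move=> /gcompE[ba d1 d2 d3] Aa /gcompE[da c1 c2 c3].
  have /(_ ba) ba' := (bA _ _ Ab Aa').1; subst a'.
  have /(_ (etrans (esym d3) da)) ab := (bA _ _ Ab Aa).2; subst a.
  suff -> : c = b by [].
  by apply: arrowP => //; rewrite ?c1 ?d1 ?c2 ?d2 ?gdegV ?addrN ?add0r.
have [e ee] := @gcomp_ex a (ginv a) erefl.
exists e, a; split=> //; first by exists a, (ginv a); split=> //; exists a.
move: ee => /gcompE[_ e1 e2 e3]; apply/gcompE; split=> //.
by rewrite e2 gdegV addrN add0r.
Qed.

Lemma set_invK : involutive set_inv.
Proof.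
move=> A; apply/seteqP; split=> [_ [_ [a Aa <-] <-]|a Aa]; first by rewrite ginvK.
by exists (ginv a); [exists a|rewrite ginvK].
Qed.

Lemma bisection_inv A : bisection A -> bisection (set_inv A).
Proof.
move=> /bisectionP bA; apply/bisectionP => _ _ [a Aa <-] [b Ab <-].
have [h1 h2] := bA _ _ Aa Ab.
by rewrite !gdomV !gcodV; split=> [/h2|/h1] ->.
Qed.

Lemma bisection_mul A B : bisection A -> bisection B -> bisection (set_mul A B).
Proof.
move=> /bisectionP bA /bisectionP bB; apply/bisectionP => c c'.
move=> [a [b [Aa Bb /gcompE[ab c1 c2 c3]]]] [a' [b' [Aa' Bb' /gcompE[ab' c1' c2' c3']]]].
rewrite c1 c3 c1' c3'; have [a1 a2] := bA _ _ Aa Aa'; have [b1 b2] := bB _ _ Bb Bb'.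
split=> [/b1 bb|/a2 aa].
  have aa : a = a' by apply: a1; rewrite ab ab' bb.
  by apply: arrowP; rewrite ?c1 ?c2 ?c3 ?c1' ?c2' ?c3' ?aa ?bb.
have bb : b = b' by apply: b2; rewrite -ab -ab' aa.
by apply: arrowP; rewrite ?c1 ?c2 ?c3 ?c1' ?c2' ?c3' ?aa ?bb.
Qed.

Lemma set_pinv_uniq A B : bisection A -> bisection B ->
  set_mul (set_mul A B) A = A -> set_mul (set_mul B A) B = B -> B = set_inv A.
Proof.
have half C D : bisection C -> set_mul (set_mul C D) C = C -> set_inv C `<=` D.
  move=> /bisectionP bC e _ [c Cc <-].
  have := Cc; rewrite -{1}e => -[f [c' [[c'' [d [Cc'' Dd]]]]]].
  move=> /gcompE[cd f1 f2 f3] Cc' /gcompE[fc' k1 k2 k3].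
  have cc' := (bC _ _ Cc Cc').1 k3; subst c'.
  have cc'' := (bC _ _ Cc Cc'').2 (etrans k1 f1); subst c''.
  suff -> : ginv c = d by [].
  apply: arrowP; rewrite ?gcodV ?gdomV ?gdegV //; last by rewrite -fc' f3.
  move: k2; rewrite f2; lia.
move=> bA bB e1 e2; apply/seteqP; split; last exact: half bA e1.
move=> b Bb; exists (ginv b); last exact: ginvK.
by apply: (half _ _ bB e2); exists b.
Qed.

End Bisections.

Arguments identities : clear implicits.
Arguments cuntz_bisections : clear implicits.

Section CompactOpen.
Variable n : nat.
Notation G := (cuntz n).
Notation str := (seq 'I_n).
Implicit Types (x y z u v : str) (w : omega_word n) (g h a b c : G).
Implicit Types (A B C : set G).

Lemma cyl_arrow_subproof x y w :
  cuntz_arrows (catw x w, ((size x)%:Z - (size y)%:Z)%R, catw y w).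
Proof. by exists x, y, w. Qed.

Definition cyl_arrow x y w : G := mk_arrow (cyl_arrow_subproof x y w).

Lemma cylinderE x y : cylinder x y = range (cyl_arrow x y).
Proof.
apply/seteqP; split=> [g [w _ e]|_ [w _ <-]]; last by exists w.
by exists w => //; apply: val_inj; rewrite e.
Qed.

Lemma cyl_arrow_continuous x y : continuous (cyl_arrow x y).
Proof.
apply/continuousP => _ [D sD <-]; rewrite preimage_bigcup; apply: bigcup_open.
move=> B /sD[x' [y' [V [oV ->]]]]; apply/open_wordP => w Bw.
have cw : cylinder x y (cyl_arrow x y w) by rewrite cylinderE; exists w.
have [[z [xE yE]]|[z [xE yE]]] := basic_set_cases cw Bw.
  move: Bw; rewrite xE yE /= basic_set_cat => -[_ [v Vv <-] [e _]].
  have /open_wordP oz := open_catw z oV.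
  have zVw : (catw z @` V) w by exists v => //; exact/esym/(catw_inj e).
  have [k kV] := oz w zVw.
  by exists k => w' /kV h; exists w'.
have Vz : V (catw z w).
  by case: Bw => v Vv [e _ _]; rewrite xE catwA in e; rewrite (catw_inj e).
have /open_wordP oz := open_catwV z oV.
have [k kV] := oz w Vz.
exists k => w' /kV h; exists (catw z w') => //=.
by rewrite xE yE !catwA !size_cat; congr (_, _, _); lia.
Qed.

Lemma cylinder_compact x y : compact (cylinder x y).
Proof.
rewrite cylinderE; apply: continuous_compact; last exact: omega_word_compact.
exact/continuous_subspaceT/cyl_arrow_continuous.
Qed.

Lemma cylinder_open x y : open (cylinder x y).
Proof. exact/open_basic/openT. Qed.

Lemma cylinder_bisection x y : bisection (cylinder x y).
Proof.
apply/bisectionP => a b; rewrite cylinderE => -[w _ <-] [w' _ <-].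
by split=> /catw_inj ->.
Qed.

Lemma compact_openP A : compact A /\ open A <->
  exists s : seq (str * str), A = \big[setU/set0]_(p <- s) cylinder p.1 p.2.
Proof.
split=> [[cA oA]|[s ->]]; last first.
  split; first by apply: bigsetU_compact => p _; exact: cylinder_compact.
  elim/big_ind : _; [exact: open0|exact: openU|by move=> p _; exact: cylinder_open].
have [->|/set0P[a0 _]] := eqVneq A set0; first by exists [::]; rewrite big_nil.
pose G' : ptopologicalType := HB.pack G (isPointed.Build G a0).
have cA' : cover_compact (T := G') A by rewrite -compact_cover.
pose D := [set p : str * str | cylinder p.1 p.2 `<=` A].
have [||D' D'D AD'] := cA' _ D (fun p => cylinder p.1 p.2).
- by move=> p _; exact: cylinder_open.
- move=> g /(open_cuntzP oA)[x [y [V [/open_wordP oV [w Vw gE] sA]]]].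
  have [k kV] := oV _ Vw; pose z := mkseq w k.
  have [w' w'E] : exists w', w = catw z w'.
    rewrite /z; elim: k w {z Vw gE kV} => [|k ih] w; first by exists w.
    have [w' w'E] := ih (fun i => w i.+1); exists w'; apply/funext => -[|i] //=.
    have := congr1 (@^~ i) w'E; rewrite /mkseq (iotaDl 1 0) -map_comp.
    exact.
  exists (x ++ z, y ++ z); last by exists w' => //=; rewrite gE w'E !catwA !size_cat; congr (_, _, _); lia.
  rewrite /D/= /cylinder basic_set_cat => h [_ [v _ <-] hE]; apply: sA.
  exists (catw z v) => //; apply: kV => i ik.
  by rewrite w'E; apply: catw_lt; rewrite size_mkseq.
exists (finmap.enum_fset D'); apply/seteqP; split.
  by move=> g /AD'[p pD' pg]; rewrite -bigcup_seq; exists p.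
by rewrite -bigcup_seq => g [p pD']; have := D'D p pD'; rewrite inE => h /h.
Qed.

Definition psi_set (s : polycyclic n) : set G :=
  if s is Some (x, y) then cylinder x y else set0.

Lemma psi_set_mul s t : set_mul (psi_set s) (psi_set t) = psi_set (s * t)%g.
Proof.
case: s t => [[x y]|] [[u v]|]; last 3 first.
- by apply/seteqP; split=> // c [a [b []]].
- by apply/seteqP; split=> // c [a [b []]].
- by apply/seteqP; split=> // c [a [b []]].
rewrite [(_ * _)%g]/mul/=.
case: ifPn => [/prefixP[z ->]|yu].
  rewrite drop_size_cat//= !cylinderE; apply/seteqP; split.
    move=> c [_ [_ [[w _ <-] [w' _ <-]]]] /gcompP[/=].
    rewrite /gdom/gcod/gdeg/= catwA => /catw_inj -> ce; exists w' => //.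
    by apply: val_inj; apply: etrans (esym ce); rewrite /= catwA !size_cat; congr (_, _, _); lia.
  move=> _ [w _ <-]; exists (cyl_arrow x y (catw z w)), (cyl_arrow (y ++ z) v w).
  split; [by exists (catw z w)|by exists w|apply/gcompP].
  rewrite /gdom/gcod/gdeg/= !catwA !size_cat; split=> //; congr (_, _, _); lia.
case: ifPn => [/prefixP[z ->]|uy].
  rewrite drop_size_cat//= !cylinderE; apply/seteqP; split.
    move=> c [_ [_ [[w _ <-] [w' _ <-]]]] /gcompP[/=].
    rewrite /gdom/gcod/gdeg/= catwA => /catw_inj <- ce; exists w => //.
    by apply: val_inj; apply: etrans (esym ce); rewrite /= catwA !size_cat; congr (_, _, _); lia.
  move=> _ [w _ <-]; exists (cyl_arrow x (u ++ z) w), (cyl_arrow u v (catw z w)).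
  split; [by exists w|by exists (catw z w)|apply/gcompP].
  rewrite /gdom/gcod/gdeg/= !catwA !size_cat; split=> //; congr (_, _, _); lia.
apply/seteqP; split=> // c [a [b []]] /=; rewrite !cylinderE.
move=> [w _ <-] [w' _ <-] /gcompP[+ _]; rewrite /gdom/gcod/=.
have [le|/ltnW le] := leqP (size y) (size u).
  by move=> /(catw_eq le)[z uE _]; move: yu; rewrite uE prefix_prefix.
by move=> /esym/(catw_eq le)[z yE _]; move: uy; rewrite yE prefix_prefix.
Qed.

Lemma identitiesE : identities n = cylinder [::] [::].
Proof.
rewrite cylinderE; apply/seteqP; split=> [e /identitiesP[e1 e2]|_ [w _ <-]].
  by exists (gcod e) => //; apply: arrowP.
by apply/identitiesP.
Qed.

Lemma set_inv_cylinder x y : set_inv (cylinder x y) = cylinder y x.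
Proof.
rewrite !cylinderE; apply/seteqP; split.
  by move=> _ [_ [w _ <-] <-]; exists w => //; apply: arrowP; rewrite // gdegV /gdeg/= opprB.
move=> _ [w _ <-]; exists (cyl_arrow x y w); first by exists w.
by apply: arrowP; rewrite // gdegV /gdeg/= opprB.
Qed.

Lemma cuntz_bisections_one : cuntz_bisections n (identities n).
Proof.
rewrite identitiesE; split; [exact: cylinder_compact|exact: cylinder_open|].
exact: cylinder_bisection.
Qed.

Lemma cuntz_bisections0 : cuntz_bisections n (@set0 G).
Proof. by split; [exact: compact0|exact: open0|]. Qed.

Lemma cuntz_bisections_psi s : cuntz_bisections n (psi_set s).
Proof.
case: s => [[x y]|]; last exact: cuntz_bisections0.
split; [exact: cylinder_compact|exact: cylinder_open|exact: cylinder_bisection].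
Qed.

Lemma cuntz_bisections_inv A : cuntz_bisections n A -> cuntz_bisections n (set_inv A).
Proof.
move=> [cA oA bA]; have [s AE] := (compact_openP A).1 (conj cA oA).
suff [] : compact (set_inv A) /\ open (set_inv A).
  by split=> //; exact: bisection_inv.
apply/compact_openP; exists [seq (p.2, p.1) | p <- s]; rewrite big_map AE.
rewrite /set_inv -!bigcup_seq image_bigcup; apply: eq_bigcupr => p _.
exact: set_inv_cylinder.
Qed.

Lemma set_mulUl A B C : set_mul (A `|` B) C = set_mul A C `|` set_mul B C.
Proof.
apply/seteqP; split=> c.
  by move=> [a [b [[Aa|Ba] Cb e]]]; [left|right]; exists a, b.
by move=> [|] [a [b [ABa Cb e]]]; exists a, b; split=> //; [left|right].
Qed.

Lemma set_mulUr A B C : set_mul C (A `|` B) = set_mul C A `|` set_mul C B.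
Proof.
apply/seteqP; split=> c.
  by move=> [a [b [Ca [Ab|Bb] e]]]; [left|right]; exists a, b.
by move=> [|] [a [b [Ca ABb e]]]; exists a, b; split=> //; [left|right].
Qed.

Lemma cuntz_bisections_mul A B :
  cuntz_bisections n A -> cuntz_bisections n B -> cuntz_bisections n (set_mul A B).
Proof.
move=> [cA oA bA] [cB oB bB].
have [s AE] := (compact_openP A).1 (conj cA oA).
have [t BE] := (compact_openP B).1 (conj cB oB).
suff [] : compact (set_mul A B) /\ open (set_mul A B).
  by split=> //; exact: bisection_mul.
have mul0 C : set_mul set0 C = set0 by apply/seteqP; split=> // c [a [b []]].
have mulr0 C : set_mul C set0 = set0 by apply/seteqP; split=> // c [a [b []]].
rewrite AE; elim: s {AE} => [|[x y] s [ihc iho]].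
  by rewrite big_nil mul0; split; [exact: compact0|exact: open0].
rewrite big_cons set_mulUl.
suff [cC oC] : compact (set_mul (cylinder x y) B) /\ open (set_mul (cylinder x y) B).
  by split; [exact: compactU|exact: openU].
rewrite BE; elim: t {BE ihc iho} => [|[u v] t [ihc iho]].
  by rewrite big_nil mulr0; split; [exact: compact0|exact: open0].
rewrite big_cons set_mulUr.
have /= -> := psi_set_mul (Some (x, y)) (Some (u, v)).
have [? ? _] := cuntz_bisections_psi ((Some (x, y) : polycyclic n) * Some (u, v))%g.
by split; [exact: compactU|exact: openU].
Qed.

End CompactOpen.

Definition cuntz_monoid (n : nat) : Type := set_type (cuntz_bisections n).

HB.instance Definition _ n := Choice.on (cuntz_monoid n).

Section CuntzMonoid.
Variable n : nat.
Notation Cn := (cuntz_monoid n).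
Implicit Types A B : Cn.

Definition mk_bisection (A : set (cuntz n)) (bA : cuntz_bisections n A) : Cn :=
  exist (fun B : set (cuntz n) => B \in cuntz_bisections n) A (mem_set bA).

Definition cn_mul A B : Cn :=
  mk_bisection (cuntz_bisections_mul (set_valP A) (set_valP B)).
Definition cn_inv A : Cn := mk_bisection (cuntz_bisections_inv (set_valP A)).
Definition cn_one : Cn := mk_bisection (cuntz_bisections_one n).
Definition cn_zero : Cn := mk_bisection (cuntz_bisections0 n).

Let cn_mulA : associative cn_mul.
Proof. by move=> A B C; apply: val_inj; exact: set_mulA. Qed.
Let cn_mul1 : left_id cn_one cn_mul.
Proof. by move=> A; apply: val_inj; exact: set_mul1. Qed.
Let cn_mulr1 : right_id cn_one cn_mul.
Proof. by move=> A; apply: val_inj; exact: set_mulr1. Qed.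

HB.instance Definition _ := isMonoid.Build Cn cn_mulA cn_mul1 cn_mulr1.

Let cn_mul0 : left_zero cn_zero cn_mul.
Proof. by move=> A; apply: val_inj; apply/seteqP; split=> // c [a [b []]]. Qed.
Let cn_mulr0 : right_zero cn_zero cn_mul.
Proof. by move=> A; apply: val_inj; apply/seteqP; split=> // c [a [b []]]. Qed.
Let cn_mulgVg A : cn_mul (cn_mul A (cn_inv A)) A = A.
Proof. by apply: val_inj; apply: set_mulgVg; have [] := set_valP A. Qed.
Let cn_mulVgV A : cn_mul (cn_mul (cn_inv A) A) (cn_inv A) = cn_inv A.
Proof.
by have := cn_mulgVg (cn_inv A); congr (cn_mul (cn_mul _ _) _ = _);
   apply: val_inj; exact: set_invK.
Qed.
Let cn_pinv_uniq A B :
  cn_mul (cn_mul A B) A = A -> cn_mul (cn_mul B A) B = B -> B = cn_inv A.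
Proof.
move=> /(congr1 val) e1 /(congr1 val) e2; apply: val_inj.
by apply: set_pinv_uniq => //; [have [] := set_valP A|have [] := set_valP B].
Qed.

HB.instance Definition _ := Monoid_isInverseMonoid0.Build Cn
  cn_mul0 cn_mulr0 cn_mulgVg cn_mulVgV cn_pinv_uniq.

Definition psi (s : polycyclic n) : Cn := mk_bisection (cuntz_bisections_psi s).

End CuntzMonoid.

Definition strong (n : nat) (S : inverseMonoid0Type)
    (theta : polycyclic n -> S) :=
  monoid0_morphism theta /\
  is_join (range (fun i : 'I_n => theta (gen i * (gen i)^-1)%g)) 1%g.

Definition strong_orthogonal_completion (n : nat) (C : inverseMonoid0Type)
    (psi : polycyclic n -> C) :=
  [/\ orthogonally_complete C, strong psi
    & forall (S : inverseMonoid0Type) (theta : polycyclic n -> S),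
        orthogonally_complete S -> strong theta ->
        exists! thetabar : C -> S,
          [/\ monoid0_morphism thetabar, preserves_orthogonal_joins thetabar
            & thetabar \o psi = theta]].

Definition has_prefix (n : nat) (x : seq 'I_n) (w : omega_word n) :=
  exists v, w = catw x v.

Definition thompson (n : nat) : set (omega_word n -> omega_word n) :=
  [set f | bijective f /\
    exists (m : nat) (x y : 'I_m -> seq 'I_n),
      [/\ forall w, exists! i, has_prefix (x i) w,
          forall w, exists! i, has_prefix (y i) w
        & forall i w, f (catw (x i) w) = catw (y i) w]].

Arguments thompson : clear implicits.

(* Main.v *)
Require Import Defs.
From mathcomp Require Import all_boot.
From mathcomp Require Import ssralg ssrint.
From mathcomp Require Import all_classical topology zify.

(** Every compact open bisection is a finite union of cylinders [U_{x,y}], and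
    two cylinders are nested or disjoint; hence every element of the monoid [C_n]
    is a finite orthogonal join of elements [psi (x y^-1)]
    ([bisection_decomposition]).

    In [C_n] the natural order is inclusion ([nat_le_bisectionP]) and
    orthogonality means having disjoint sources and disjoint targets, so
    orthogonal joins are unions and meets are intersections. Cylinders are
    closed, so compact open sets of arrows are stable under difference, and the
    idempotents, which are the compact open sets of identities, form a boolean
    algebra.

    For the universal property, let [theta] be a strong morphism into an
    orthogonally complete [S]. Strongness says that [theta (x y^-1)] is the join
    of the elements [theta (xa (ya)^-1)], where [a] runs over the letters, and by
    iteration of those with [a] running over the strings of any fixed length.
    If [U_{x,y}] is covered by finitely many cylinders, then for strings [a]
    that are long enough each [U_{xa,ya}] lies in one member of the cover;
    therefore an upper bound in [S] for the cover also bounds [theta (x y^-1)]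
    ([strong_le_cover]). So if a bisection is the union of the cylinders of two
    finite families, the images of the two families under [theta] have the same
    upper bounds, and the extension, namely the join of the images, is
    well defined ([extension_exists]). Its value can thus be computed from any
    finite family of cylinders with the right union, orthogonal or not, which
    makes multiplicativity and the preservation of joins immediate. Uniqueness
    follows from the decomposition.

    A bisection is a unit exactly when every word is the source of one of its arrows and
    the target of one of them ([unitsP]). It then sends the source of each of its
    arrows to the target, and a decomposition into disjoint cylinders [U_{y,x}]
    displays this map as an element of the Thompson group. The map determines
    the bisection, that is, also the integers carried by the arrows: two
    cylinders with the same source string that induce the same map have the same
    target string, since with at least two letters no nonempty string [z]
    satisfies [zw = w] for all words [w] ([catw_fun_inj]). *)

Set Implicit Arguments.
Unset Strict Implicit.
Unset Printing Implicit Defensive.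

Local Open Scope classical_set_scope.

(** * Joins in inverse monoids *)

Section InverseMonoid.
Variable S : inverseMonoid0Type.
Implicit Types (s t u v e f : S) (F H : set S).

Lemma idempotent_elt_inv e : idempotent_elt e -> (e^-1 = e)%g.
Proof. by move=> ee; apply/esym/pinv_uniq; rewrite !ee. Qed.

(** The product [f e] is an inverse of [e f], so [e f] is idempotent; being
    equal to its own inverse, it is then equal to [f e]. *)
Lemma idempotent_eltC e f :
  idempotent_elt e -> idempotent_elt f -> (e * f = f * e)%g.
Proof.
move=> ee ff.
have efV : ((e * f)^-1 = f * e)%g by rewrite invgM !idempotent_elt_inv.
have efi : idempotent_elt (e * f)%g.
  have := mulgVg (e * f)%g; rewrite efV /idempotent_elt !mulgA.
  by rewrite -[(e * f * f)%g]mulgA ff -[(e * f * e * e)%g]mulgA ee.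
by rewrite -efV idempotent_elt_inv.
Qed.

Lemma idempotent_elt_mul e f :
  idempotent_elt e -> idempotent_elt f -> idempotent_elt (e * f)%g.
Proof.
move=> ee ff; rewrite /idempotent_elt mulgA -[(e * f * e)%g]mulgA.
by rewrite (idempotent_eltC ff ee) mulgA ee -mulgA ff.
Qed.

Lemma idempotent_elt1 : idempotent_elt (1%g : S).
Proof. exact: mulg1. Qed.

Lemma idempotent_elt_mulVg s : idempotent_elt (s^-1 * s)%g.
Proof. by rewrite /idempotent_elt -mulgA (mulgA s) mulgVg. Qed.

Lemma nat_lexx s : nat_le s s.
Proof. by exists 1%g; rewrite ?mulg1 //; exact: idempotent_elt1. Qed.

Lemma nat_le_trans s t u : nat_le s t -> nat_le t u -> nat_le s u.
Proof.
move=> [e ee ->] [f ff ->]; exists (f * e)%g; last by rewrite mulgA.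
exact: idempotent_elt_mul.
Qed.

Lemma nat_le_anti s t : nat_le s t -> nat_le t s -> s = t.
Proof.
move=> [e ee se] [f ff tf].
have /= et : (t * e)%g = t.
  by rewrite {1}tf -mulgA (idempotent_eltC ff ee) mulgA {1}se -(mulgA t) ee -se -tf.
by rewrite se et.
Qed.

Lemma is_join_uniq F u v : is_join F u -> is_join F v -> u = v.
Proof. by move=> [uF uL] [vF vL]; apply: nat_le_anti; [exact: uL|exact: vL]. Qed.

Lemma is_join_set1 s : is_join [set s] s.
Proof. by split=> [_ ->|v]; [exact: nat_lexx|exact]. Qed.

(** Inserting the idempotent [t^-1 * t] between [s^-1] and [u] keeps a zero
    product zero, since it commutes with [s * s^-1]. *)
Lemma orthogonal_mull t s u : orthogonal s u -> orthogonal (t * s)%g (t * u)%g.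
Proof.
move=> [su0 us0]; split; rewrite invgM.
  have idem := idempotent_eltC (idempotent_elt_mulVg (s^-1)%g) (idempotent_elt_mulVg t).
  rewrite invgK in idem.
  have sV := mulgVg (s^-1)%g; rewrite invgK -mulgA in sV.
  rewrite -mulgA [(t^-1 * _)%g]mulgA -[X in (X * _)%g]sV -(mulgA s^-1%g) (mulgA (s * s^-1)%g) idem.
  by rewrite -!mulgA su0 !muls0.
by rewrite -mulgA (mulgA s) us0 mul0s muls0.
Qed.

Lemma finite_orthogonal_mull t F :
  finite_orthogonal F -> finite_orthogonal [set (t * s)%g | s in F].
Proof.
move=> [finF oF]; split; first exact: finite_image.
move=> _ _ [s Fs <-] [u Fu <-] tsu; apply: orthogonal_mull.
by apply: oF => // su; apply: tsu; rewrite su.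
Qed.

Lemma is_join_mul F H u v : orthogonally_complete S ->
  finite_orthogonal F -> finite_orthogonal H -> is_join F u -> is_join H v ->
  is_join [set (s * t)%g | s in F & t in H] (u * v)%g.
Proof.
move=> [_ dist] oF oH ju jv.
have [_ [uvU uvL]] := dist F u v oF ju.
have vH s : is_join [set (s * t)%g | t in H] (s * v)%g by have [] := dist H v s oH jv.
split=> [_ [s Fs [t Ht <-]]|w wU].
  apply: (@nat_le_trans _ (s * v)%g); last by apply: uvU; exists s.
  by apply: (vH s).1; exists t.
apply: uvL => _ [s Fs <-]; apply: (vH s).2 => _ [t Ht <-].
by apply: wU; exists s => //; exists t.
Qed.

End InverseMonoid.

Section Morphism.
Variables (S T : inverseMonoid0Type) (f : S -> T).
Hypothesis fM : monoid0_morphism f.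
Implicit Types s t : S.

Lemma morphism_mul s t : f (s * t)%g = (f s * f t)%g.
Proof. by have [[_ ->]] := fM. Qed.

Lemma morphism_inv s : f (s^-1)%g = ((f s)^-1)%g.
Proof.
apply: pinv_uniq; rewrite -!morphism_mul ?mulgVg //.
by have := mulgVg (s^-1)%g; rewrite invgK => ->.
Qed.

Lemma morphism_le s t : nat_le s t -> nat_le (f s) (f t).
Proof.
move=> [e ee ->]; exists (f e); last exact: morphism_mul.
by rewrite /idempotent_elt -morphism_mul ee.
Qed.

Lemma morphism_orthogonal s t : orthogonal s t -> orthogonal (f s) (f t).
Proof.
have [_ f0] := fM.
by move=> [h1 h2]; split; rewrite -morphism_inv -morphism_mul ?h1 ?h2.
Qed.

Lemma morphism_finite_orthogonal F :
  finite_orthogonal F -> finite_orthogonal (f @` F).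
Proof.
move=> [finF oF]; split; first exact: finite_image.
move=> _ _ [s Fs <-] [t Ft <-] fst; apply: morphism_orthogonal.
by apply: oF => // st; apply: fst; rewrite st.
Qed.

End Morphism.

(** * Compact open sets of arrows *)

Section Arrows.
Variable n : nat.
Implicit Types (x y u v : seq 'I_n) (w : omega_word n) (a b c : cuntz n).
Implicit Types (A B : set (cuntz n)) (p q : seq 'I_n * seq 'I_n).

Lemma cylinder_cat x y u : cylinder (x ++ u) (y ++ u) `<=` cylinder x y.
Proof. by rewrite /cylinder basic_set_cat => a [w _ aE]; exists w. Qed.

Lemma cylinder_gcod x y a : cylinder x y a -> has_prefix x (gcod a).
Proof. by rewrite cylinderE => -[w _ <-]; exists w. Qed.

Lemma cylinder_gdom x y a : cylinder x y a -> has_prefix y (gdom a).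
Proof. by rewrite cylinderE => -[w _ <-]; exists w. Qed.

Lemma cylinder_sub_or_disjoint p q :
  [\/ cylinder p.1 p.2 `<=` cylinder q.1 q.2,
      cylinder q.1 q.2 `<=` cylinder p.1 p.2
    | cylinder p.1 p.2 `&` cylinder q.1 q.2 = set0].
Proof.
have [->|/set0P[a [pa qa]]] := eqVneq (cylinder p.1 p.2 `&` cylinder q.1 q.2) set0.
  by constructor 3.
have [[z [-> ->]]|[z [-> ->]]] := basic_set_cases pa qa.
  by constructor 2; exact: cylinder_cat.
by constructor 1; exact: cylinder_cat.
Qed.

(** Two cylinders are nested or disjoint, so keeping the maximal ones among
    finitely many cylinders makes their union disjoint. *)
Lemma bigcup_cylinder_disjoint (s : seq (seq 'I_n * seq 'I_n)) :
  exists t : seq (seq 'I_n * seq 'I_n),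
  [/\ uniq t,
      {in t &, forall p q, p <> q -> cylinder p.1 p.2 `&` cylinder q.1 q.2 = set0}
    & \bigcup_(p in [set` t]) cylinder p.1 p.2 =
      \bigcup_(p in [set` s]) cylinder p.1 p.2].
Proof.
elim: s => [|p s [t [ut dt tE]]]; first by exists [::].
have consE r : \bigcup_(q in [set` p :: r]) cylinder q.1 q.2 =
    cylinder p.1 p.2 `|` \bigcup_(q in [set` r]) cylinder q.1 q.2.
  by rewrite !bigcup_seq big_cons.
have [[q qt pq]|np] := pselect (exists2 q, q \in t & cylinder p.1 p.2 `<=` cylinder q.1 q.2).
  exists t; split=> //; rewrite consE tE; apply/esym/setUidPr.
  by rewrite -tE => a /pq qa; exists q.
pose P q := `[< cylinder p.1 p.2 `&` cylinder q.1 q.2 = set0 >].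
exists (p :: [seq q <- t | P q]); split.
- rewrite /= filter_uniq // andbT mem_filter; apply/negP => /andP[_ pt].
  by apply: np; exists p.
- move=> q r; rewrite !inE !mem_filter.
  move=> /predU1P[->|/andP[/asboolP Pq qt]] /predU1P[->|/andP[/asboolP Pr rt]] //.
  + by rewrite setIC.
  + exact: dt.
- rewrite !consE -tE; apply/seteqP; split=> a.
    move=> [pa|[q /=]]; first by left.
    by rewrite mem_filter => /andP[_ qt] qa; right; exists q.
  move=> [pa|[q qt qa]]; first by left.
  have [pq|qp|pq0] := cylinder_sub_or_disjoint p q.
  + by case: np; exists q.
  + by left; exact: qp.
  + by right; exists q => //=; rewrite mem_filter qt andbT; apply/asboolP.
Qed.

Lemma bigcup_cylinder_compact_open (s : seq (seq 'I_n * seq 'I_n)) :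
  compact (\bigcup_(p in [set` s]) cylinder p.1 p.2) /\
  open (\bigcup_(p in [set` s]) cylinder p.1 p.2).
Proof. by apply/compact_openP; exists s; rewrite bigcup_seq. Qed.

Lemma compact_openI A B :
  compact A -> open A -> compact B -> open B ->
  compact (A `&` B) /\ open (A `&` B).
Proof.
move=> cA oA cB oB; split; last exact: openI.
have [s AE] := (compact_openP A).1 (conj cA oA).
have [t BE] := (compact_openP B).1 (conj cB oB).
rewrite AE BE big_distrl/=; apply: bigsetU_compact => p _.
rewrite big_distrr/=; apply: bigsetU_compact => q _.
have [pq|qp|->] := cylinder_sub_or_disjoint p q; last exact: compact0.
  by rewrite (setIidl pq); exact: cylinder_compact.
by rewrite (setIidr qp); exact: cylinder_compact.
Qed.

Lemma catw_split k w : exists z w', size z = k /\ w = catw z w'.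
Proof.
elim: k w => [|k ih] w; first by exists [::], w.
have [z [v [zk wE]]] := ih (fun i => w i.+1).
exists (w 0%N :: z), v; split; first by rewrite /= zk.
by apply/funext => -[|i] //=; rewrite -[RHS](congr1 (@^~ i) wE).
Qed.

Lemma cylinder_extend x y a k : cylinder x y a ->
  exists2 z, size z = k & cylinder (x ++ z) (y ++ z) a.
Proof.
move=> [w _ aE]; have [z [w' [zk wE]]] := catw_split k w.
by exists z => //; rewrite /cylinder basic_set_cat; exists w => //; exists w'.
Qed.

(** An arrow lies in a cylinder whose target string is at least as long as [x].
    If this cylinder met [cylinder x y], it would be contained in it, so it
    avoids [cylinder x y] when the arrow does. *)
Lemma cylinder_closed x y : closed (cylinder x y).
Proof.
rewrite -openC -[X in open X](_ : \bigcup_(p in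
  [set p | cylinder p.1 p.2 `&` cylinder x y = set0]) cylinder p.1 p.2 = _).
  by apply: bigcup_open => p _; exact: cylinder_open.
apply/seteqP; split=> b; first by move=> [p /= p0 pb] xyb; have : set0 b by rewrite -p0.
move=> nb; have [u [v [w bE]]] := set_valP b.
have buv : cylinder u v b by exists w.
have [z zk bz] := cylinder_extend (size x) buv.
exists (u ++ z, v ++ z) => //=.
rewrite -subset0 => a [az axy].
have [[t [xE yE]]|[t [xE yE]]] := basic_set_cases az axy; last first.
  by apply: nb; move: bz; rewrite xE yE; exact: cylinder_cat.
have t0 : t = [::] by apply: size0nil; move: (congr1 size xE); rewrite !size_cat; lia.
by apply: nb; rewrite xE yE t0 !cats0.
Qed.

Lemma compact_openD A B :
  compact A -> open A -> compact B -> open B ->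
  compact (A `\` B) /\ open (A `\` B).
Proof.
move=> cA oA cB oB; split; first by apply: compact_closedI => //; rewrite -openC setCK.
apply: openI => //; rewrite openC.
have [s ->] := (compact_openP B).1 (conj cB oB).
by apply: closed_bigsetU => p _; exact: cylinder_closed.
Qed.

End Arrows.

(** * The boolean inverse monoid of compact open bisections *)

Section Bisections.
Variable n : nat.
Implicit Types a b c : cuntz n.
Implicit Types (A B C : cuntz_monoid n) (F : set (cuntz_monoid n)).

Lemma bisection_dom_inj A a b : val A a -> val A b -> gdom a = gdom b -> a = b.
Proof. by have [_ _ /bisectionP bA] := set_valP A => Aa Ab; have [] := bA a b Aa Ab. Qed.

Lemma bisection_cod_inj A a b : val A a -> val A b -> gcod a = gcod b -> a = b.
Proof. by have [_ _ /bisectionP bA] := set_valP A => Aa Ab; have [] := bA a b Aa Ab. Qed.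

Lemma bisection_sub A (B : set (cuntz n)) : B `<=` val A -> bisection B.
Proof.
move=> BA; apply/bisectionP => a b /BA Aa /BA Ab.
by split; [exact: bisection_dom_inj Aa Ab|exact: bisection_cod_inj Aa Ab].
Qed.

Lemma idempotent_bisectionP A : idempotent_elt A <-> val A `<=` identities n.
Proof.
split=> [/(congr1 val)/= AA a Aa|AI].
  move: (Aa); rewrite -{1}AA => -[b [c [Ab Ac /gcompE[bc c1 c2 c3]]]].
  have ca := bisection_dom_inj Ac Aa (esym c3).
  have ba := bisection_cod_inj Ab Aa (esym c1).
  move: bc c2; rewrite ba ca => bc c2; apply/identitiesP; split=> //; lia.
apply: val_inj; apply/seteqP; split=> [c [a [b [Aa Ab /gcompE[ab c1 c2 c3]]]]|a Aa].
  have /identitiesP[a1 a2] := AI _ Aa.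
  suff -> : c = b by [].
  by apply: arrowP => //; rewrite ?c1 ?a1 // c2 a2 GRing.add0r.
have /identitiesP[a1 a2] := AI _ Aa.
by exists a, a; split=> //; apply/gcompE; rewrite a1 a2.
Qed.

(** If [A] is contained in [B], then it is the restriction [B * (A^-1 * A)] of [B]
    to the sources of [A]; conversely, multiplying by a set of identities
    restricts. *)
Lemma nat_le_bisectionP A B : nat_le A B <-> val A `<=` val B.
Proof.
split=> [[E /idempotent_bisectionP EI ->] c|AB].
  move=> [b [e [Bb /EI/identitiesP[e1 e2] /gcompE[be c1 c2 c3]]]].
  suff -> : c = b by [].
  by apply: arrowP => //; rewrite ?c2 ?e2 ?GRing.addr0 // c3 -e1.
exists (A^-1 * A)%g; first exact: idempotent_elt_mulVg.
apply: val_inj; apply/seteqP; split=> [a Aa|c].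
  have [e ee] := @gcomp_ex _ (ginv a) a erefl.
  have [e0 e1 e2 e3] := (gcompE _ _ _).1 ee.
  exists a, e; split; [exact: AB|by exists (ginv a), a; split=> //; exists a|].
  apply/gcompE; split=> //; rewrite e2 gdegV; lia.
move=> [b [e [Bb [_ [a' [[a Aa <-] Aa' /gcompE[aa' e1 e2 e3]]]]]]].
move=> /gcompE[be c1 c2 c3].
have aE : a = a' by apply: bisection_cod_inj Aa Aa' aa'.
have bE : b = a by apply: bisection_dom_inj Bb (AB _ Aa) _; rewrite be e1.
suff -> : c = a by [].
apply: arrowP; rewrite ?c1 ?c2 ?c3 ?e2 ?e3 ?bE -?aE // gdegV; lia.
Qed.

Lemma orthogonal_bisectionP A B : orthogonal A B <-> forall a b,
  val A a -> val B b -> gdom a <> gdom b /\ gcod a <> gcod b.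
Proof.
split=> [[/(congr1 val)/= h1 /(congr1 val)/= h2] a b Aa Bb|h].
  split=> ab.
    have [c cE] := @gcomp_ex _ a (ginv b) ab.
    suff : set0 c by [].
    rewrite -h2; exists a, (ginv b); split=> //; by exists b.
  have [c cE] := @gcomp_ex _ (ginv a) b ab.
  suff : set0 c by [].
  rewrite -h1; exists (ginv a), b; split=> //; by exists a.
split; apply: val_inj; apply/seteqP; split=> // c [].
  by move=> _ [b [[a Aa <-] Bb /gcompE[ab _ _ _]]]; have [_ []] := h _ _ Aa Bb.
by move=> a [_ [Aa [b Bb <-] /gcompE[ab _ _ _]]]; have [[]] := h _ _ Aa Bb.
Qed.

(** Arrows of a bisection with a common source or a common target are equal. *)
Lemma disjoint_orthogonal C A B :
  val A `<=` val C -> val B `<=` val C -> val A `&` val B = set0 ->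
  orthogonal A B.
Proof.
move=> AC BC AB0; apply/orthogonal_bisectionP => a b Aa Bb.
split=> [/bisection_dom_inj|/bisection_cod_inj] /(_ _ (AC _ Aa) (BC _ Bb)) ab;
  suff : set0 a by []; rewrite -AB0; split=> //; by rewrite ab.
Qed.

Lemma bigcup_is_join F A : val A = \bigcup_(B in F) val B -> is_join F A.
Proof.
move=> AE; split=> [B FB|C FC].
  by apply/nat_le_bisectionP; rewrite AE => b Bb; exists B.
apply/nat_le_bisectionP; rewrite AE => b [B FB Bb].
by have /nat_le_bisectionP := FC B FB; apply.
Qed.

Lemma finite_orthogonal_bigcup F :
  finite_orthogonal F -> exists A, val A = \bigcup_(B in F) val B.
Proof.
move=> [/finite_seqP[s FE] oF].
suff bF : cuntz_bisections n (\bigcup_(B in F) val B) by exists (mk_bisection bF).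
split.
- rewrite FE bigcup_seq; apply: bigsetU_compact => B _.
  by have [] := set_valP B.
- by apply: bigcup_open => B _; have [] := set_valP B.
- apply/bisectionP => a b [A FA Aa] [B FB Bb].
  have [AB|AB] := pselect (A = B).
    by subst B; split; [exact: bisection_dom_inj Aa Bb|exact: bisection_cod_inj Aa Bb].
  have /orthogonal_bisectionP oAB := oF _ _ FA FB AB.
  by have [nd nc] := oAB _ _ Aa Bb.
Qed.

Lemma is_join_bigcup F A :
  finite_orthogonal F -> is_join F A -> val A = \bigcup_(B in F) val B.
Proof.
move=> /finite_orthogonal_bigcup[B BE] jA.
by rewrite -BE; congr val; apply: is_join_uniq jA (bigcup_is_join BE).
Qed.

Lemma cuntz_orthogonally_complete : orthogonally_complete (cuntz_monoid n).
Proof.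
split=> [F oF|F A C oF jA].
  by have [A AE] := finite_orthogonal_bigcup oF; exists A; exact: bigcup_is_join.
have AE := is_join_bigcup oF jA; split; apply: bigcup_is_join; rewrite bigcup_image.
  apply/seteqP; split=> c.
    move=> [b [a [Cb]]]; rewrite AE => -[B FB Ba] ba.
    by exists B => //; exists b, a.
  move=> [B FB [b [a [Cb Ba ba]]]]; exists b, a; split=> //.
  by rewrite AE; exists B.
apply/seteqP; split=> c.
  move=> [a [b []]]; rewrite AE => -[B FB Ba] Cb ab.
  by exists B => //; exists a, b.
move=> [B FB [a [b [Ba Cb ab]]]]; exists a, b; split=> //.
by rewrite AE; exists B.
Qed.

Lemma cuntz_meet A B : exists C, is_meet [set A; B] C.
Proof.
have [cA oA _] := set_valP A; have [cB oB _] := set_valP B.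
have [cAB oAB] := compact_openI cA oA cB oB.
have bAB : cuntz_bisections n (val A `&` val B).
  by split=> //; apply: (@bisection_sub A) => a [].
exists (mk_bisection bAB); split=> [C [->|->]|C CAB].
- by apply/nat_le_bisectionP => a [].
- by apply/nat_le_bisectionP => a [].
- apply/nat_le_bisectionP => c Cc.
  have /nat_le_bisectionP CA : nat_le C A by apply: CAB; left.
  have /nat_le_bisectionP CB : nat_le C B by apply: CAB; right.
  by split; [exact: CA|exact: CB].
Qed.

Lemma idempotent_mulE A B : idempotent_elt A -> idempotent_elt B ->
  val (A * B)%g = val A `&` val B.
Proof.
move=> /idempotent_bisectionP AI /idempotent_bisectionP BI.
apply/seteqP; split=> [c [a [b [Aa Bb /gcompE[ab c1 c2 c3]]]]|a [Aa Ba]].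
  have /identitiesP[a1 a2] := AI _ Aa; have /identitiesP[b1 b2] := BI _ Bb.
  have ca : c = a by apply: arrowP; rewrite ?c1 ?c2 ?a2 ?b2 // c3 -b1.
  have cb : c = b by apply: arrowP; rewrite ?c3 ?c2 ?a2 ?b2 // c1 a1.
  by split; [rewrite ca|rewrite cb].
have /identitiesP[a1 a2] := AI _ Aa.
by exists a, a; split=> //; apply/gcompE; rewrite a1 a2.
Qed.

(** Idempotents are the compact open sets of identities, a field of sets. *)
Lemma cuntz_boolean_idempotents : boolean_idempotents (cuntz_monoid n).
Proof.
have [cI oI bI] := cuntz_bisections_one n.
have subI (E : set (cuntz n)) : compact E -> open E -> E `<=` identities n ->
    cuntz_bisections n E.
  by move=> cE oE EI; split=> //; apply: (@bisection_sub 1%g).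
(* The operations have to be total; 1 is a junk value. *)
pose mk (E : set (cuntz n)) : cuntz_monoid n :=
  if pselect (cuntz_bisections n E) is left bE then mk_bisection bE else 1%g.
have mkE (E : set (cuntz n)) : compact E -> open E -> E `<=` identities n -> val (mk E) = E.
  by move=> cE oE EI; rewrite /mk; case: pselect => // -[]; exact: subI.
pose join A B := mk (val A `|` val B); pose compl A := mk (identities n `\` val A).
have joinE A B : idempotent_elt A -> idempotent_elt B -> val (join A B) = val A `|` val B.
  move=> /idempotent_bisectionP AI /idempotent_bisectionP BI.
  have [cA oA _] := set_valP A; have [cB oB _] := set_valP B.
  by apply: mkE; [exact: compactU|exact: openU|rewrite subUset].
have complE A : val (compl A) = identities n `\` val A.
  have [cA oA _] := set_valP A; have [? ?] := compact_openD cI oI cA oA.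
  by apply: mkE => // a [].
have joinI A B : idempotent_elt A -> idempotent_elt B -> idempotent_elt (join A B).
  move=> AI BI; apply/idempotent_bisectionP; rewrite joinE // subUset.
  by split; apply/idempotent_bisectionP.
have complI A : idempotent_elt (compl A).
  by apply/idempotent_bisectionP; rewrite complE => a [].
have mulI := @idempotent_elt_mul (cuntz_monoid n).
exists join, compl => e f g eI fI gI; split; [exact: joinI|exact: complI|].
split; try apply: val_inj.
- by rewrite !joinE // setUC.
- by rewrite !joinE ?setUA //; exact: joinI.
- by rewrite joinE ?idempotent_mulE //; try exact: mulI; apply/setUidPl => a [].
- by rewrite idempotent_mulE ?joinE //; try exact: joinI; apply/setIidPl => a; left.
split; apply: val_inj.
- by rewrite joinE ?idempotent_mulE ?joinE ?setIUr //; auto.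
- by rewrite joinE // complE; apply/setDUK/idempotent_bisectionP.
- by rewrite idempotent_mulE // complE setDE setICA setICr setI0.
Qed.

Lemma cuntz_boolean : boolean_inverse_monoid (cuntz_monoid n).
Proof.
split; [exact: cuntz_orthogonally_complete|exact: cuntz_boolean_idempotents|].
exact: cuntz_meet.
Qed.

End Bisections.

(** * The universal property *)

Section PolycyclicMonoid.
Variable n : nat.
Implicit Types x y z : seq 'I_n.

Lemma psi_morphism : monoid0_morphism (@psi n).
Proof.
split; last exact: val_inj.
split=> [|s t]; apply: val_inj; last exact/esym/psi_set_mul.
exact/esym/identitiesE.
Qed.

Lemma gen_mulV (i : 'I_n) : (gen i * (gen i)^-1)%g = Some ([:: i], [:: i]) :> polycyclic n.
Proof. by []. Qed.

Lemma psi_strong : strong (@psi n).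
Proof.
split; first exact: psi_morphism.
apply: bigcup_is_join; rewrite bigcup_image /= identitiesE !cylinderE.
apply/seteqP; split=> a.
  move=> [w _ <-]; exists (w 0%N) => //; rewrite cylinderE.
  exists (fun k => w k.+1) => //.
  by apply: arrowP => //; apply/funext => -[].
move=> [i _]; rewrite cylinderE => -[w _ <-].
by exists (catw [:: i] w) => //; apply: arrowP.
Qed.

Lemma polycyclic_cat_le x y z :
  nat_le (Some (x ++ z, y ++ z) : polycyclic n) (Some (x, y)).
Proof.
exists (Some (y ++ z, y ++ z)).
  by rewrite /idempotent_elt [(_ * _)%g]/mul /= prefix_refl drop_size cats0.
by rewrite [(_ * _)%g]/mul /= prefix_prefix drop_size_cat.
Qed.

Lemma rcons_factor x y i :
  ((Some (x, [::]) : polycyclic n) * (gen i * (gen i)^-1) * Some ([::], y))%g =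
  Some (rcons x i, rcons y i).
Proof. by rewrite gen_mulV [in LHS]/mul /= !cats1. Qed.

Lemma gen_finite_orthogonal :
  finite_orthogonal (range (fun i : 'I_n => gen i * (gen i)^-1)%g).
Proof.
split; first by apply: finite_image; exact: finite_finset.
move=> _ _ [i _ <-] [j _ <-] ij.
have /negPf ijF : i != j by apply/eqP => e; apply: ij; rewrite e.
have jiF : (j == i) = false by rewrite eq_sym.
by split; rewrite !gen_mulV [(_ * _)%g]/mul /= ?ijF ?jiF.
Qed.

End PolycyclicMonoid.

Section Decomposition.
Variable n : nat.
Hypothesis n_gt0 : (0 < n)%N.
Implicit Types (A : cuntz_monoid n) (s t : polycyclic n).

Lemma psi_eq0 s : psi s = zerog -> s = zerog.
Proof.
case: s => [[x y]|] // /(congr1 val)/= xy0.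
have : set0 (cyl_arrow x y (fun=> Ordinal n_gt0)).
  by rewrite -xy0 cylinderE; exists (fun=> Ordinal n_gt0).
by [].
Qed.

(** Nonempty cylinders make [psi] vanish only at zero, so orthogonality can be
    checked on bisections. *)
Lemma psi_orthogonal s t : orthogonal (psi s) (psi t) -> orthogonal s t.
Proof.
have pM := psi_morphism n.
by move=> [h1 h2]; split; apply: psi_eq0; rewrite (morphism_mul pM) (morphism_inv pM).
Qed.

Lemma bisection_cylinders A : exists r : seq (seq 'I_n * seq 'I_n),
  [/\ uniq r,
      {in r &, forall p q, p <> q -> cylinder p.1 p.2 `&` cylinder q.1 q.2 = set0}
    & val A = \bigcup_(p in [set` r]) cylinder p.1 p.2].
Proof.
have [cA oA _] := set_valP A.
have [s AE] := (compact_openP (val A)).1 (conj cA oA).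
have [r [ur dr rE]] := bigcup_cylinder_disjoint s.
by exists r; split=> //; rewrite rE AE bigcup_seq.
Qed.

Lemma bisection_decomposition A : exists F : set (polycyclic n),
  finite_orthogonal F /\ val A = \bigcup_(p in F) psi_set p.
Proof.
have [r [_ dr AE]] := bisection_cylinders A.
exists (Some @` [set` r]); split; last first.
  by rewrite AE bigcup_image; apply: eq_bigcupr => -[].
split; first exact: finite_image.
move=> _ _ [[x y] rp <-] [[u v] rq <-] pq; apply: psi_orthogonal.
apply: (@disjoint_orthogonal _ A); rewrite ?AE.
- by move=> a pa; exists (x, y).
- by move=> a qa; exists (u, v).
- by apply: (dr _ _ rp rq) => e; apply: pq; rewrite e.
Qed.

End Decomposition.

Section Extension.
Variables (n : nat) (S : inverseMonoid0Type) (theta : polycyclic n -> S).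
Hypothesis n_gt0 : (0 < n)%N.
Hypothesis S_complete : orthogonally_complete S.
Hypothesis theta_strong : strong theta.
Implicit Types (x y z : seq 'I_n) (A B : cuntz_monoid n) (p q : polycyclic n).
Implicit Types (F : set (polycyclic n)) (v : S).

Let thetaM : monoid0_morphism theta. Proof. by case: theta_strong. Qed.

(** Writing [theta (x y^-1)] as [theta x * 1 * theta y^-1] and expanding 1 as the
    join of the [theta (i i^-1)] displays it as a join of the [theta (xi (yi)^-1)]. *)
Lemma strong_le_rcons x y v :
  (forall i, nat_le (theta (Some (rcons x i, rcons y i))) v) ->
  nat_le (theta (Some (x, y))) v.
Proof.
move=> le_v; have [_ j1] := theta_strong.
have oF : finite_orthogonal (range (fun i : 'I_n => theta (gen i * (gen i)^-1)%g)).
  by rewrite -image_comp; exact/morphism_finite_orthogonal/gen_finite_orthogonal.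
have [jx _] := S_complete.2 _ _ (theta (Some (x, [::]))) oF j1.
have oxF := finite_orthogonal_mull (theta (Some (x, [::]))) oF.
have [_ jxy] := S_complete.2 _ _ (theta (Some ([::], y))) oxF jx.
have xyE : (theta (Some (x, [::])) * 1 * theta (Some ([::], y)))%g = theta (Some (x, y)).
  by rewrite mulg1 -(morphism_mul thetaM) [(_ * _)%g]/mul /= cats0.
rewrite xyE in jxy; apply: jxy.2 => _ [_ [_ [i _ <-] <-] <-].
rewrite -!(morphism_mul thetaM) rcons_factor; exact: le_v.
Qed.

Lemma strong_le_cat k x y v :
  (forall z, size z = k -> nat_le (theta (Some (x ++ z, y ++ z))) v) ->
  nat_le (theta (Some (x, y))) v.
Proof.
elim: k x y => [|k ih] x y le_v.
  by have := le_v [::] erefl; rewrite !cats0.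
apply: strong_le_rcons => i; apply: ih => z zk.
by rewrite !cat_rcons; apply: le_v; rewrite /= zk.
Qed.

(** Once the string [z] is as long as every target string in [F], the cylinder of
    [Some (x ++ z, y ++ z)] lies in a single cylinder of the cover, where the
    order of the polycyclic monoid gives the bound; [strong_le_cat] then
    descends to [p]. *)
Lemma strong_le_cover p F v : finite_set F ->
  psi_set p `<=` \bigcup_(q in F) psi_set q ->
  (forall q, F q -> nat_le (theta q) v) -> nat_le (theta p) v.
Proof.
move=> /finite_seqP[s FE] pF Fv; case: p pF => [[x y]|] pF; last first.
  have [_ ->] := thetaM; exists zerog; last by rewrite muls0.
  by rewrite /idempotent_elt mul0s.
pose len q := if q is Some (u, _) then size u else 0%N.
apply: (@strong_le_cat (\max_(q <- s) len q)) => z zk.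
pose a := cyl_arrow (x ++ z) (y ++ z) (fun=> Ordinal n_gt0).
have az : cylinder (x ++ z) (y ++ z) a by rewrite cylinderE; eexists.
have [[[u v']|] // Fq aq] := pF _ (cylinder_cat az).
have ule : (size u <= size z)%N.
  by move: Fq; rewrite FE zk /= => qs; exact: (@leq_bigmax_seq _ s xpredT len _ qs).
suff [t [-> ->]] : exists t, x ++ z = u ++ t /\ y ++ z = v' ++ t.
  apply: nat_le_trans (Fv _ Fq); apply: (morphism_le thetaM).
  exact: polycyclic_cat_le.
have [[t [uE vE]]|//] := basic_set_cases az aq.
have t0 : t = [::] by apply: size0nil; move: (congr1 size uE); rewrite !size_cat; lia.
by exists [::]; rewrite uE vE t0 !cats0.
Qed.

(** The value at [A] is the join over an orthogonal decomposition of [A]. By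
    [strong_le_cover], any finite family of cylinders with union [A] has the same
    upper bounds, even if the cylinders overlap; products and joins of
    bisections can then be evaluated without making their cylinders disjoint. *)
Lemma extension_exists : exists f : cuntz_monoid n -> S,
  forall A F, finite_set F -> val A = \bigcup_(p in F) psi_set p ->
    is_join (theta @` F) (f A).
Proof.
suff /choice[f fP] : forall A, exists u, forall F, finite_set F ->
  val A = \bigcup_(p in F) psi_set p -> is_join (theta @` F) u by exists f.
move=> A; have [F0 [oF0 AE0]] := bisection_decomposition n_gt0 A.
have [u [uU uL]] := S_complete.1 _ (morphism_finite_orthogonal thetaM oF0).
exists u => F finF AE; split=> [_ [p Fp <-]|v vU].
  apply: strong_le_cover oF0.1 _ _ => [|q F0q]; last by apply: uU; exists q.
  by rewrite -AE0 AE => a pa; exists p.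
apply: uL => _ [p F0p <-]; apply: strong_le_cover finF _ _ => [|q Fq].
  by rewrite -AE AE0 => a pa; exists p.
by apply: vU; exists q.
Qed.

Section ExtensionProperties.
Variable f : cuntz_monoid n -> S.
Hypothesis f_join : forall A F, finite_set F -> val A = \bigcup_(p in F) psi_set p ->
  is_join (theta @` F) (f A).

Lemma extension_psi p : f (psi p) = theta p.
Proof.
have pE : val (psi p) = \bigcup_(q in [set p]) psi_set q by rewrite bigcup_set1.
have jp := f_join (finite_set1 p) pE.
by apply: is_join_uniq jp _; rewrite image_set1; exact: is_join_set1.
Qed.

Lemma extension_mul A B : f (A * B)%g = (f A * f B)%g.
Proof.
have [F [oF AE]] := bisection_decomposition n_gt0 A.
have [H [oH BE]] := bisection_decomposition n_gt0 B.
have jFH := is_join_mul S_complete (morphism_finite_orthogonal thetaM oF)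
  (morphism_finite_orthogonal thetaM oH) (f_join oF.1 AE) (f_join oH.1 BE).
apply: is_join_uniq jFH.
rewrite [X in is_join X](_ : _ = theta @` [set (p * q)%g | p in F & q in H]); last first.
  apply/seteqP; split.
    move=> _ [_ [p Fp <-] [_ [q Hq <-] <-]]; rewrite -(morphism_mul thetaM).
    by exists (p * q)%g => //; exists p => //; exists q.
  move=> _ [_ [p Fp [q Hq <-]] <-]; rewrite (morphism_mul thetaM).
  by exists (theta p); [exists p|exists (theta q) => //; exists q].
apply: f_join; first exact: finite_image2 oF.1 oH.1.
apply/seteqP; split=> c.
  rewrite /= AE BE => -[a [b [[p Fp pa] [q Hq qb] ab]]].
  exists (p * q)%g; first by exists p => //; exists q.
  by rewrite -psi_set_mul; exists a, b.
move=> [_ [p Fp [q Hq <-]]]; rewrite -psi_set_mul => -[a [b [pa qb ab]]].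
by exists a, b; split=> //; [rewrite AE; exists p|rewrite BE; exists q].
Qed.

Lemma extension_morphism : monoid0_morphism f.
Proof.
have [[p1 _] p0] := psi_morphism n; have [[t1 _] t0] := thetaM.
split; last by rewrite -p0 extension_psi.
by split=> [|A B]; [rewrite -p1 extension_psi|exact: extension_mul].
Qed.

Lemma extension_preserves_joins : preserves_orthogonal_joins f.
Proof.
move=> F A oF jA; have AE := is_join_bigcup oF jA.
have /choice[H HP] := bisection_decomposition n_gt0.
pose G := \bigcup_(B in F) H B.
have finG : finite_set G by apply: bigcup_finite oF.1 _ => B _; have [[]] := HP B.
have AG : val A = \bigcup_(p in G) psi_set p.
  rewrite AE; apply/seteqP; split=> a.
    by move=> [B FB]; have [_ ->] := HP B => -[p Hp pa]; exists p => //; exists B.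
  by move=> [p [B FB Hp] pa]; exists B => //; have [_ ->] := HP B; exists p.
have [AU AL] := f_join finG AG.
have jH B : is_join (theta @` H B) (f B).
  by have [[finH _] BE] := HP B; exact: f_join.
split=> [_ [B FB <-]|v vU].
  by apply: (jH B).2 => _ [p Hp <-]; apply: AU; exists p => //; exists B.
apply: AL => _ [p [B FB Hp] <-]; apply: (@nat_le_trans _ _ (f B)).
  by apply: (jH B).1; exists p.
by apply: vU; exists B.
Qed.

End ExtensionProperties.

Lemma extension_unique (f g : cuntz_monoid n -> S) :
  preserves_orthogonal_joins f -> preserves_orthogonal_joins g ->
  f \o @psi n = theta -> g \o @psi n = theta -> f = g.
Proof.
move=> fJ gJ fE gE; apply/funext => A.
have [F [oF AE]] := bisection_decomposition n_gt0 A.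
have oP := morphism_finite_orthogonal (psi_morphism n) oF.
have jA : is_join (@psi n @` F) A by apply: bigcup_is_join; rewrite bigcup_image.
have := fJ _ _ oP jA; have := gJ _ _ oP jA.
by rewrite !image_comp fE gE => jg jf; exact: is_join_uniq jf jg.
Qed.

End Extension.

Lemma psi_strong_orthogonal_completion n :
  (0 < n)%N -> strong_orthogonal_completion (@psi n).
Proof.
move=> n_gt0; split; [exact: cuntz_orthogonally_complete|exact: psi_strong|].
move=> S theta S_complete theta_strong.
have [f fP] := extension_exists n_gt0 S_complete theta_strong.
have fJ := extension_preserves_joins n_gt0 fP.
have fE : f \o @psi n = theta by apply/funext => p; exact: extension_psi.
exists f; split; first by split=> //; exact: extension_morphism fP.
by move=> g [_ gJ gE]; exact: extension_unique fJ gJ fE gE.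
Qed.

(** * The group of units *)

Section Units.
Variable n : nat.
Implicit Types (x y z : seq 'I_n) (w : omega_word n) (a b c : cuntz n).
Implicit Types A B : cuntz_monoid n.

(** When all words are sources and targets of arrows of [A], the idempotents
    [A * A^-1] and [A^-1 * A] contain every identity, so [A^-1] inverts [A]. *)
Lemma unitsP A : units (cuntz_monoid n) A <->
  forall w, (exists2 a, val A a & gdom a = w) /\ (exists2 a, val A a & gcod a = w).
Proof.
split=> [[B [/(congr1 val)/= AB /(congr1 val)/= BA]] w|dcA].
  have idw : identities n (cyl_arrow [::] [::] w) by apply/identitiesP.
  split.
    move: idw; rewrite -BA => -[b [a [_ Aa /gcompE[_ _ _ e]]]].
    by exists a.
  move: idw; rewrite -AB => -[a [b [Aa _ /gcompE[_ e _ _]]]].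
  by exists a.
have idE B : idempotent_elt B ->
    (forall w, exists2 a, val B a & gcod a = w) -> B = 1%g.
  move=> /idempotent_bisectionP BI cB; apply: val_inj; apply/seteqP; split=> // e.
  move=> /identitiesP[e1 e2]; have [a Ba ae] := cB (gcod e).
  have /identitiesP[a1 a2] := BI _ Ba.
  suff -> : e = a by [].
  by apply: arrowP; rewrite ?e2 ?a2 // -e1 -ae a1.
have ginv_comp B a : val B a -> exists2 e, val (B^-1 * B)%g e & gcod e = gdom a.
  move=> Ba; have [e ee] := @gcomp_ex _ (ginv a) a erefl.
  have [_ e1 _ _] := (gcompE _ _ _).1 ee.
  by exists e => //; exists (ginv a), a; split=> //; exists a.
exists (A^-1)%g; split; apply: idE.
- by have := idempotent_elt_mulVg (A^-1)%g; rewrite invgK.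
- move=> w; have [_ [a Aa <-]] := dcA w.
  have [|e] := ginv_comp (A^-1)%g (ginv a); first by exists a.
  by rewrite invgK; exists e.
- exact: idempotent_elt_mulVg.
- by move=> w; have [[a Aa <-] _] := dcA w; exact: ginv_comp.
Qed.

Lemma units_inv A : units (cuntz_monoid n) A -> units (cuntz_monoid n) (A^-1)%g.
Proof.
move=> /unitsP dcA; apply/unitsP => w; have [[a Aa aw] [b Ab bw]] := dcA w.
by split; [exists (ginv b) => //; exists b|exists (ginv a) => //; exists a].
Qed.

(** The value at words that are not the source of an arrow of [A] is junk;
    there are none when [A] is a unit. *)
Definition bisection_map A w : omega_word n :=
  if pselect (exists a, val A a /\ gdom a = w) is left e
  then gcod (sval (cid e)) else w.

Lemma bisection_mapE A a : val A a -> bisection_map A (gdom a) = gcod a.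
Proof.
move=> Aa; rewrite /bisection_map; case: pselect => [e|[]]; last by exists a.
by case: cid => b /= [Ab ba]; rewrite (bisection_dom_inj Ab Aa ba).
Qed.

Lemma bisection_map_mul A B :
  units (cuntz_monoid n) A -> units (cuntz_monoid n) B ->
  bisection_map (A * B)%g = bisection_map A \o bisection_map B.
Proof.
move=> /unitsP dcA /unitsP dcB; apply/funext => w /=.
have [[b Bb <-] _] := dcB w; have [[a Aa ab] _] := dcA (gcod b).
have [c cE] := gcomp_ex ab; have [_ c1 _ c3] := (gcompE _ _ _).1 cE.
rewrite (bisection_mapE Bb) -ab (bisection_mapE Aa) -c1 -c3.
by apply: bisection_mapE; exists a, b.
Qed.

Lemma bisection_mapK A : units (cuntz_monoid n) A ->
  cancel (bisection_map A) (bisection_map (A^-1)%g).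
Proof.
move=> /unitsP dcA w; have [[a Aa <-] _] := dcA w.
rewrite (bisection_mapE Aa) -gdomV -gcodV; apply: bisection_mapE.
by exists a.
Qed.

Lemma bisection_map_thompson A :
  units (cuntz_monoid n) A -> thompson n (bisection_map A).
Proof.
move=> uA; split.
  exists (bisection_map (A^-1)%g); first exact: bisection_mapK.
  by have := bisection_mapK (units_inv uA); rewrite invgK.
have /unitsP dcA := uA; have [r [ur dr AE]] := bisection_cylinders A.
pose p i := tnth (in_tuple r) i.
have cyl_in i a : cylinder (p i).1 (p i).2 a -> val A a.
  by rewrite AE => pa; exists (p i) => //=; exact: mem_tnth.
have in_cyl a : val A a -> exists i, cylinder (p i).1 (p i).2 a.
  by rewrite AE => -[q /= /(tnthP (in_tuple r))[i ->]]; exists i.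
have p_inj i j a : cylinder (p i).1 (p i).2 a -> cylinder (p j).1 (p j).2 a -> i = j.
  move=> ia ja; have p_inj : injective p by apply/tuple_uniqP.
  apply: p_inj; apply: contrapT => pij.
  suff : set0 a by [].
  rewrite -(dr (p i) (p j)) //; exact: mem_tnth.
(* [cylinder y x] maps [x w] to [y w]: its source string comes second. *)
exists (size r), (fun i => (p i).2), (fun i => (p i).1); split.
- move=> w; have [[a Aa aw] _] := dcA w; have [i ia] := in_cyl a Aa.
  exists i; split; first by rewrite -aw; exact: cylinder_gdom ia.
  move=> j [v wv]; pose b := cyl_arrow (p j).1 (p j).2 v.
  have jb : cylinder (p j).1 (p j).2 b by rewrite cylinderE; exists v.
  suff ab : a = b by apply: p_inj ia _; rewrite ab.
  by apply: bisection_dom_inj Aa (cyl_in _ _ jb) _; rewrite aw wv.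
- move=> w; have [_ [a Aa aw]] := dcA w; have [i ia] := in_cyl a Aa.
  exists i; split; first by rewrite -aw; exact: cylinder_gcod ia.
  move=> j [v wv]; pose b := cyl_arrow (p j).1 (p j).2 v.
  have jb : cylinder (p j).1 (p j).2 b by rewrite cylinderE; exists v.
  suff ab : a = b by apply: p_inj ia _; rewrite ab.
  by apply: bisection_cod_inj Aa (cyl_in _ _ jb) _; rewrite aw wv.
- move=> i w; pose b := cyl_arrow (p i).1 (p i).2 w.
  apply: (@bisection_mapE A b); apply: (cyl_in i).
  by rewrite cylinderE; exists w.
Qed.

(** If [y = x ++ z], then [catw z w = w] for all [w]; a nonempty [z] would force
    the first letter of every [w], but there are two letters. *)
Lemma catw_fun_inj x y : (1 < n)%N -> (forall w, catw x w = catw y w) -> x = y.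
Proof.
move=> n_gt1; wlog xy : x y / (size x <= size y)%N => [H e|e].
  have [|/ltnW] := leqP (size x) (size y) => le; first exact: H.
  by apply/esym/H.
pose i0 : 'I_n := Ordinal (ltnW n_gt1); pose i1 : 'I_n := Ordinal n_gt1.
have [[|i z] yE _] := catw_eq xy (e (fun=> i0)); first by rewrite yE cats0.
have wE w : w 0%N = i.
  by have := e w; rewrite yE catwA => /catw_inj /(congr1 (@^~ 0%N)).
by have := etrans (wE (fun=> i0)) (esym (wE (fun=> i1))).
Qed.

Lemma cylinder_neighborhood A a : val A a ->
  exists x y, cylinder x y a /\ cylinder x y `<=` val A.
Proof.
have [r [_ _ AE]] := bisection_cylinders A.
rewrite AE => -[[x y] rxy xya]; exists x, y; split=> // b xyb.
by exists (x, y).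
Qed.

(** Two cylinders inside [A] and [B] around arrows with the same source can be
    refined to have the same source string; if [A] and [B] induce the same map,
    their target strings then agree as well. *)
Lemma bisection_map_sub A B : (1 < n)%N -> units (cuntz_monoid n) B ->
  bisection_map A = bisection_map B -> val A `<=` val B.
Proof.
move=> n_gt1 /unitsP dcB AB a Aa; have [[b Bb ba] _] := dcB (gdom a).
have [x [y [xya xyA]]] := cylinder_neighborhood Aa.
have [x' [y' [xyb xyB]]] := cylinder_neighborhood Bb.
(* These lengths make [y ++ z] and [y' ++ z'] equally long prefixes of the
   common source, hence equal. *)
have [z zk za] := cylinder_extend (size y') xya.
have [z' zk' zb] := cylinder_extend (size y) xyb.
have cA := subset_trans (@cylinder_cat n x y z) xyA.
have cB := subset_trans (@cylinder_cat n x' y' z') xyB.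
have yE : y ++ z = y' ++ z'.
  have [[w wE] [w' wE']] := (cylinder_gdom za, cylinder_gdom zb).
  have le : (size (y ++ z) <= size (y' ++ z'))%N by rewrite !size_cat zk zk' addnC.
  have [t tE _] := catw_eq le (etrans (esym wE) (etrans (esym ba) wE')).
  have t0 : t = [::].
    by apply: size0nil; move: (congr1 size tE); rewrite !size_cat zk zk'; lia.
  by rewrite tE t0 cats0.
have xE : x ++ z = x' ++ z'.
  apply: catw_fun_inj n_gt1 _ => w.
  have aA : val A (cyl_arrow (x ++ z) (y ++ z) w) by apply: cA; rewrite cylinderE; exists w.
  have bB : val B (cyl_arrow (x' ++ z') (y' ++ z') w) by apply: cB; rewrite cylinderE; exists w.
  have awE : bisection_map A (catw (y ++ z) w) = catw (x ++ z) w := bisection_mapE aA.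
  have bwE : bisection_map B (catw (y' ++ z') w) = catw (x' ++ z') w := bisection_mapE bB.
  by rewrite -awE -bwE AB yE.
by apply: cB; rewrite -xE -yE.
Qed.

Lemma thompson_bisection_map f : thompson n f ->
  exists2 A, units (cuntz_monoid n) A & bisection_map A = f.
Proof.
move=> [_ [m [x [y [xP yP fE]]]]].
pose E : set (cuntz n) := \bigcup_(i in [set: 'I_m]) cylinder (y i) (x i).
have EE : E = \bigcup_(p in [set` [seq (y i, x i) | i <- enum 'I_m]]) cylinder p.1 p.2.
  apply/seteqP; split=> a.
    move=> [i _ ia]; exists (y i, x i) => //=; apply/mapP; exists i => //.
    by rewrite mem_enum.
  by move=> [p /= /mapP[i _ ->]] ia; exists i.
have [cE oE] := bigcup_cylinder_compact_open [seq (y i, x i) | i <- enum 'I_m].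
rewrite -EE in cE oE.
have bE : bisection E.
  apply/bisectionP => a b [i _ ia] [j _ jb].
  have /bisectionP bi := @cylinder_bisection n (y i) (x i).
  have eq_ij (p : 'I_m -> seq 'I_n) w : (forall w, exists! k, has_prefix (p k) w) ->
      has_prefix (p i) w -> has_prefix (p j) w -> i = j.
    by move=> /(_ w)[k [_ kU]] pi pj; rewrite -(kU i pi) -(kU j pj).
  split=> ab.
    have ij : i = j.
      apply: (eq_ij x (gdom a)) => //; first exact: cylinder_gdom ia.
      by rewrite ab; exact: cylinder_gdom jb.
    by subst j; apply: (bi _ _ ia jb).1.
  have ij : i = j.
    apply: (eq_ij y (gcod a)) => //; first exact: cylinder_gcod ia.
    by rewrite ab; exact: cylinder_gcod jb.
  by subst j; apply: (bi _ _ ia jb).2.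
have cylE i w : E (cyl_arrow (y i) (x i) w).
  by exists i => //; rewrite cylinderE; exists w.
pose A : cuntz_monoid n := mk_bisection (And3 cE oE bE).
exists A.
  apply/unitsP => w; have [i [[v wv] _]] := xP w; have [j [[v' wv'] _]] := yP w.
  split; first by exists (cyl_arrow (y i) (x i) v); [exact: cylE|exact: esym].
  by exists (cyl_arrow (y j) (x j) v'); [exact: cylE|exact: esym].
apply/funext => w; have [i [[v ->] _]] := xP w.
by rewrite fE; apply: (@bisection_mapE A (cyl_arrow (y i) (x i) v)); exact: cylE.
Qed.

End Units.

Theorem proposition3p1 (n : nat) (hn : (2 <= n)%N) :
  boolean_inverse_monoid (cuntz_monoid n) /\
  strong_orthogonal_completion (@psi n) /\
  exists phi : cuntz_monoid n -> (omega_word n -> omega_word n),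
    set_bij (units (cuntz_monoid n)) (thompson n) phi /\
    (forall u v : cuntz_monoid n,
       units (cuntz_monoid n) u -> units (cuntz_monoid n) v ->
       phi (u * v)%g = phi u \o phi v).
Proof.
split; first exact: cuntz_boolean.
split; first exact/psi_strong_orthogonal_completion/ltnW.
exists (@bisection_map n); split; last exact: bisection_map_mul.
split.
- by move=> A /bisection_map_thompson.
- move=> A B /set_mem uA /set_mem uB AB; apply: val_inj; apply/seteqP.
  by split; apply: bisection_map_sub.
- by move=> f /thompson_bisection_map[A uA <-]; exists A.
Qed.
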